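(* Let $M$ be a connected smooth manifold, $\alpha$ a Riemannian metric on $M$ and $\beta$ a differential 1-form on $M$, and let $(M,F)$ be a Finsler space with $F=\sqrt[4]{\alpha^4+\beta^4}+\beta$. Put $\tilde F=\sqrt[4]{\alpha^4+\beta^4}$. Then $F$ is projectively flat if and only if $\tilde F$ is projectively flat.
   Context: Here $\alpha=\alpha(x,y)=\sqrt{a_{ij}(x)y^iy^j}$ is the norm on $TM$ of a Riemannian metric and $\beta=\beta(x,y)=b_i(x)y^i$ is a smooth 1-form regarded as a function on $TM$; $F$ and $\tilde F$ are functions on $TM$ taken to be Finsler metrics (positive, positively 1-homogeneous in $y$, smooth off the zero section, strongly convex; not necessarily symmetric under $y\mapsto -y$). $F$ is called the Randers change of the Quartic metric $\tilde F$. A Finsler metric $F$ is called (locally) projectively flat if all its geodesics are straight lines (in suitable local coordinates $(x^i)$ around each point). In such coordinates, with induced coordinates $(x^i,y^i)$ on $TM$, this is equivalent to the spray coefficients being of the form $G^i=P(x,y)y^i$ with $P(x,y)=\frac{1}{2F}\frac{\partial F}{\partial x^k}y^k$, and also equivalent to Hamel's relation $$\frac{\partial^2F}{\partial x^m\partial y^k}y^m-\frac{\partial F}{\partial x^k}=0\quad\text{for all }k .$$ *)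

(* Defs.v *)
From HB Require Import structures.
From mathcomp Require Import all_boot all_order all_algebra.
From mathcomp Require Import all_classical all_reals all_analysis.

Set Implicit Arguments.
Unset Strict Implicit.
Unset Printing Implicit Defensive.

Import Order.TTheory GRing.Theory Num.Theory.
Import numFieldNormedType.Exports.

Local Open Scope classical_set_scope.
Local Open Scope ring_scope.

Section SmoothMaps.
Context (R : realType) (E V : normedModType R).

Definition iterated_derive (s : seq E) (f : E -> V) : E -> V :=
  foldr (fun v g x => 'D_v g x) f s.

(* On an open subset U of a finite-dimensional E, f is of class C^oo iff all
   its iterated directional derivatives exist and are continuous on U. *)
Definition smooth_on (U : set E) (f : E -> V) : Prop :=
  forall (s : seq E) (x : E), U x ->
    {for x, continuous (iterated_derive s f)} /\
    (forall v, derivable (iterated_derive s f) x v).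

End SmoothMaps.

Record chart (R : realType) (n : nat) (M : topologicalType) := Chart {
  cdom : set M;
  cmap : M -> 'rV[R]_n;
  cinv : 'rV[R]_n -> M;
  cdom_open : open cdom;
  cimg_open : open (cmap @` cdom);
  cmapK : {in cdom, cancel cmap cinv};
  cmap_continuous : {within cdom, continuous cmap};
  cinv_continuous : {within cmap @` cdom, continuous cinv} }.

Section Charts.
Context (R : realType) (n : nat) (M : topologicalType).
Implicit Types c d : chart R n M.

Definition cimg c : set 'rV[R]_n := cmap c @` cdom c.

Definition overlap c d : set 'rV[R]_n := cmap c @` (cdom c `&` cdom d).

Definition transition c d : 'rV[R]_n -> 'rV[R]_n := cmap d \o cinv c.

Definition smoothly_compatible c d : Prop :=
  smooth_on (overlap c d) (transition c d) /\
  smooth_on (overlap d c) (transition d c).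

End Charts.

Record smooth_manifold (R : realType) (n : nat) := SmoothManifold {
  carrier :> topologicalType;
  atlas : set (chart R n carrier);
  atlas_cover : forall p : carrier, exists2 c, atlas c & cdom c p;
  atlas_compatible :
    forall c d, atlas c -> atlas d -> smoothly_compatible c d;
  manifold_hausdorff : hausdorff_space carrier;
  manifold_second_countable : @second_countable carrier }.

Arguments atlas {R n} s.

(* The maximal atlas: these are the local coordinate systems of M. *)
Definition coordinates (R : realType) (n : nat) (M : smooth_manifold R n) :
    set (chart R n M) :=
  [set c | forall d, atlas M d -> smoothly_compatible c d].
Arguments coordinates {R n} M.

(* Tensor fields on M, and functions on TM, are given by their expressions in
   all local coordinate systems, subject to the usual transformation law.  For
   a point with coordinates x in c, the tangent vector with components y in c
   has components 'D_y (transition c d) x in d.  Values of an expression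
   outside of cimg c, or for c not in coordinates M, are irrelevant. *)

Record riemannian_metric (R : realType) (n : nat) (M : smooth_manifold R n) :=
  RiemannianMetric {
  gcoef : chart R n M -> 'rV[R]_n -> 'M[R]_n;
  gcoef_smooth : forall c, coordinates M c -> smooth_on (cimg c) (gcoef c);
  gcoef_sym : forall c x, coordinates M c -> cimg c x ->
    (gcoef c x)^T = gcoef c x;
  gcoef_posdef : forall c x (y : 'rV[R]_n),
    coordinates M c -> cimg c x -> y != 0 ->
    0 < \sum_i \sum_j gcoef c x i j * y 0 i * y 0 j;
  gcoef_transition : forall c d x (y z : 'rV[R]_n),
    coordinates M c -> coordinates M d -> overlap c d x ->
    \sum_i \sum_j gcoef d (transition c d x) i j
       * ('D_y (transition c d) x) 0 i * ('D_z (transition c d) x) 0 j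
    = \sum_i \sum_j gcoef c x i j * y 0 i * z 0 j }.

Record one_form (R : realType) (n : nat) (M : smooth_manifold R n) := OneForm {
  bcoef : chart R n M -> 'rV[R]_n -> 'rV[R]_n;
  bcoef_smooth : forall c, coordinates M c -> smooth_on (cimg c) (bcoef c);
  bcoef_transition : forall c d x (y : 'rV[R]_n),
    coordinates M c -> coordinates M d -> overlap c d x ->
    \sum_i bcoef d (transition c d x) 0 i * ('D_y (transition c d) x) 0 i
    = \sum_i bcoef c x 0 i * y 0 i }.

Section FinslerMetrics.
Context (R : realType) (n : nat) (M : smooth_manifold R n).

(* F c x y is the value of F at the tangent vector with induced coordinates
   (x, y) on TM, in the local coordinate system c. *)
Definition tm_expression := chart R n M -> 'rV[R]_n -> 'rV[R]_n -> R.

Definition alpha (a : riemannian_metric M) : tm_expression := fun c x y =>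
  Num.sqrt (\sum_i \sum_j gcoef a c x i j * y 0 i * y 0 j).

Definition beta (b : one_form M) : tm_expression := fun c x y =>
  \sum_i bcoef b c x 0 i * y 0 i.

Definition tm_function (F : tm_expression) : Prop :=
  forall c d x y, coordinates M c -> coordinates M d -> overlap c d x ->
    F d (transition c d x) ('D_y (transition c d) x) = F c x y.

(* g_ij = 1/2 [f^2]_{y^i y^j} *)
Definition fundamental_tensor (f : 'rV[R]_n -> 'rV[R]_n -> R)
    (x y : 'rV[R]_n) : 'M[R]_n :=
  \matrix_(i, j) (2^-1 *
    'D_(delta_mx 0 i) (fun z => 'D_(delta_mx 0 j) (fun w => f x w ^+ 2) z) y).

Definition finsler_metric (F : tm_expression) : Prop :=
  tm_function F /\
  forall c, coordinates M c ->
    [/\ smooth_on [set z : 'rV[R]_n * 'rV[R]_n | cimg c z.1 /\ z.2 != 0]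
          (fun z => F c z.1 z.2 : R^o),
        forall x y, cimg c x -> y != 0 -> 0 < F c x y,
        forall x y l, cimg c x -> 0 < l -> F c x (l *: y) = l * F c x y &
        forall x y (v : 'rV[R]_n), cimg c x -> y != 0 -> v != 0 ->
          0 < \sum_i \sum_j fundamental_tensor (F c) x y i j * v 0 i * v 0 j].

(* G^i = 1/4 g^{il} ([f^2]_{x^k y^l} y^k - [f^2]_{x^l}) *)
Definition spray_coefficients (f : 'rV[R]_n -> 'rV[R]_n -> R)
    (x y : 'rV[R]_n) : 'rV[R]_n :=
  4^-1 *:
  ((\row_l ((\sum_k
      'D_(delta_mx 0 k) (fun z => 'D_(delta_mx 0 l) (fun w => f z w ^+ 2) y) x
        * y 0 k)
      - 'D_(delta_mx 0 l) (fun z => f z y ^+ 2) x))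
   *m invmx (fundamental_tensor f x y)).

(* Coordinate expression, on an interval, of a geodesic of constant speed
   contained in the domain of coordinates with range U.  The constant curves
   are excluded, the spray being defined off the zero section. *)
Definition geodesic (f : 'rV[R]_n -> 'rV[R]_n -> R) (U : set 'rV[R]_n)
    (t0 t1 : R) (u : R -> 'rV[R]_n) : Prop :=
  forall t, t0 < t < t1 ->
    [/\ U (u t), derivable u t 1, derivable (derive1 u) t 1, derive1 u t != 0 &
        derive1 (derive1 u) t + 2 *: spray_coefficients f (u t) (derive1 u t) = 0].

Definition on_straight_line (t0 t1 : R) (u : R -> 'rV[R]_n) : Prop :=
  exists p v : 'rV[R]_n, forall t, t0 < t < t1 -> exists s : R, u t = p + s *: v.

Definition projectively_flat (F : tm_expression) : Prop :=
  forall p : M, exists c : chart R n M,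
    [/\ coordinates M c, cdom c p &
        forall t0 t1 u, geodesic (F c) (cimg c) t0 t1 u ->
          on_straight_line t0 t1 u].

End FinslerMetrics.

(* Main.v *)
Require Import Defs.
From HB Require Import structures.
From mathcomp Require Import all_boot all_order all_algebra.
From mathcomp Require Import all_classical all_reals all_analysis.
From mathcomp Require Import ring lra.

(** Both metrics are read in one coordinate system with range U, where beta is
    linear and alpha^2 is quadratic in y.  Write f for the fourth root of
    alpha^4 + beta^4 and F = f + beta.  In the same coordinates, the geodesics
    of F are straight if and only if those of f are; this is proved by passing
    through Hamel's relation.

    Straightness is Hamel's relation ([straight_geodesics_iff_hamel]).  Through
    each (x, y) with y != 0 there is a geodesic, by the Picard-Lindelof theorem
    ([second_order_solution]); if it is straight, its acceleration is a
    multiple of y, so the spray at (x, y) is a multiple of y.  Euler's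
    relations for the homogeneous function f then identify the factor and turn
    the definition of the spray into Hamel's relation.  Conversely, a spray
    that is a multiple of y gives u'' = l u', and the solutions of such an
    equation run on lines ([straight_of_parallel_acceleration]).

    Hamel's relation is linear.  The defect
       H(f)(x, y, v) = D_x[y] D_y[v] f - D_x[v] f
    is additive in f, and H(beta)(x, y, v) = d beta (y, v).  If H(F) = 0, then
    H(f) = 0 because f is the average of F and of its image under y |-> - y,
    a reflection which respects H.

    The converse needs d beta = 0 as soon as H(f) = 0.  Raising f to the fourth
    power, H(f) = 0 becomes the polynomial relation
       4 A (D_x[y] D_y[v] A - D_x[v] A) = 3 D_x[y] A . D_y[v] A
    for the quartic A = alpha^4 + beta^4.  At a point where beta does not
    vanish on a given plane, choose e1, e2 spanning the plane, orthogonal for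
    alpha, with beta(e2) = 0; with y = e1 + t e2 and v = e2 the relation is a
    polynomial identity in t.  It can be divided by alpha^2(y) = p + q t^2, and
    comparing coefficients leaves d beta (e1, e2) r^3 (p^2 + r^4) = 0, where
    r = beta(e1) ([quartic_pencil]).  So d beta vanishes on planes where beta
    does not, and on the other planes by continuity ([closed_of_hamel]).

    The spray of f is defined by inverting its fundamental tensor; that the
    tensor is invertible follows from the strong convexity of F, since f and F
    have the same second derivatives in y ([randers_nondegenerate]). *)

Import Order.TTheory GRing.Theory Num.Theory.
Import numFieldNormedType.Exports.

Local Open Scope classical_set_scope.
Local Open Scope ring_scope.

Set Implicit Arguments.
Unset Strict Implicit.
Unset Printing Implicit Defensive.

(** * Directional derivatives and smooth functions *)

Lemma is_derive_cvg (R : realType) (E W : normedModType R) (f : E -> W) x v (df : W) :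
  is_derive x v f df <->
  h^-1 *: (f (h *: v + x) - f x) @[h --> 0^'] --> df.
Proof.
split=> [[dv <-]|dv]; first exact: dv.
by split; [apply/cvg_ex; exists df | exact: cvg_lim dv].
Qed.

(** The rules of differentiation produce sums and products of functions; this
    brings their result to a pointwise form of the function and a convenient
    form of the value. *)
Lemma is_derive_congr (R : realType) (E W : normedModType R) (f g : E -> W) x v df dg :
  is_derive x v f df -> (forall z, f z = g z) -> df = dg -> is_derive x v g dg.
Proof. by move=> fdf /funext <- <-. Qed.

Section PointwiseRules.
Context (R : realType) (E : normedModType R).
Implicit Types (f g : E -> R) (x v : E).

Lemma is_derive_add f g x v (df dg : R) :
  is_derive x v (f : E -> R^o) df -> is_derive x v (g : E -> R^o) dg ->
  is_derive x v ((fun z => f z + g z) : E -> R^o) (df + dg).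
Proof. by move=> dF dG; exact: is_deriveD. Qed.

Lemma is_derive_mul f g x v (df dg : R) :
  is_derive x v (f : E -> R^o) df -> is_derive x v (g : E -> R^o) dg ->
  is_derive x v ((fun z => f z * g z) : E -> R^o) (df * g x + f x * dg).
Proof.
move=> dF dG; apply: (is_derive_congr (@is_deriveM R E f g x v _ _ dF dG)) => //.
by rewrite addrC [g x *: _]mulrC.
Qed.

Lemma is_derive_inv f x v (df : R) : f x != 0 ->
  is_derive x v (f : E -> R^o) df ->
  is_derive x v ((fun z => (f z)^-1) : E -> R^o) (- df / f x ^+ 2).
Proof.
move=> f0 [dF dE]; split; first exact: derivableV.
by rewrite (@deriveV R E f) // dE mulNr mulrC -mulNr.
Qed.

End PointwiseRules.

Section DirectionalDerivatives.
Context (R : realType) (E : normedModType R).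
Implicit Types (f g : E -> R^o) (x v w : E).

Lemma is_derive_dirZ f x v (df : R^o) (c : R) :
  is_derive x v f df -> is_derive x (c *: v) f (c * df).
Proof.
have [->|c0] := eqVneq c 0; first by rewrite scale0r mul0r => _; exact: is_derive0.
have lim0 : (fun h : R => h * c) @ 0^' --> 0^'.
  move=> A [e /= e0 eA]; exists (e / `|c|) => /=.
    by rewrite divr_gt0 // normr_gt0.
  move=> h /=; rewrite !sub0r !normrN ltr_pdivlMr ?normr_gt0 // -normrM => he h0.
  by apply: eA => /=; rewrite ?sub0r ?normrN // mulf_neq0.
move=> /is_derive_cvg dv; apply/is_derive_cvg.
rewrite (_ : (fun h => _) = (fun h : R => c *: ((h * c)^-1 *: (f ((h * c) *: v + x) - f x)))).
  by apply: cvgZr; exact: (cvg_comp _ _ lim0 dv).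
apply/funext => h; rewrite !scalerA; congr (_ *: _).
have [->|h0] := eqVneq h 0; first by rewrite mul0r invr0 mulr0.
by rewrite invfM mulrCA divff // mulr1.
Qed.

Lemma derive_dirZ f x v (c : R) :
  derivable f x v -> 'D_(c *: v) f x = c * 'D_v f x.
Proof. by move=> /derivableP /(is_derive_dirZ c) ?; rewrite derive_val. Qed.

(** Restricted to the segment from x to w + x, f is a function of one real
    variable whose derivative is the derivative of f along w. *)
Lemma segment_MVT f x w :
  (forall t : R, 0 <= t <= 1 -> derivable f (t *: w + x) w) ->
  exists2 t : R, 0 < t < 1 & f (w + x) - f x = 'D_w f (t *: w + x).
Proof.
move=> df; pose g (t : R) : R := f (t *: w + x).
have dg (t : R) : 0 <= t <= 1 -> is_derive t 1 g ('D_w f (t *: w + x)).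
  move=> /df /derivableP /is_derive_cvg dft; apply/is_derive_cvg.
  apply: cvg_trans dft; apply: near_eq_cvg; near=> h.
  by rewrite /g /= [h%:A]mulr1 scalerDl addrA.
have [t||t] := @MVT R g (fun t => 'D_w f (t *: w + x)) 0 1 ltr01.
- by rewrite in_itv /= => /andP[t0 t1]; apply: dg; rewrite !ltW.
- apply: derivable_within_continuous => t; rewrite in_itv /= => /dg ?.
  exact: ex_derive.
- by rewrite in_itv /= /g scale1r scale0r add0r subr0 mulr1; exists t.
Unshelve. all: by end_near. Qed.

End DirectionalDerivatives.

Section SmoothFunctions.
Context (R : realType) (E : normedModType R) (U : set E).
Hypothesis openU : open U.
Implicit Types (f g : E -> R^o) (x v w : E).

Lemma smooth_derivable f x v : smooth_on U f -> U x -> derivable f x v.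
Proof. by move=> sf Ux; have [_] := sf [::] x Ux; exact. Qed.

Lemma smooth_continuous f x : smooth_on U f -> U x -> {for x, continuous f}.
Proof. by move=> sf Ux; have [] := sf [::] x Ux. Qed.

Lemma smooth_derive f v : smooth_on U f -> smooth_on U ('D_v f).
Proof.
by move=> sf s x Ux; have := sf (rcons s v) x Ux; rewrite /iterated_derive foldr_rcons.
Qed.

Lemma near_open x : U x -> \forall z \near x, U z.
Proof. by move=> Ux; exact: open_nbhs_nbhs. Qed.

Lemma eq_derive_open f g x v : (forall z, U z -> f z = g z) -> U x ->
  'D_v f x = 'D_v g x.
Proof.
move=> fg Ux; apply: near_eq_derive; near=> z; apply: fg.
by near: z; exact: near_open.
Unshelve. all: by end_near. Qed.

Lemma is_derive_open f g x v df : (forall z, U z -> f z = g z) -> U x ->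
  is_derive x v f df -> is_derive x v g df.
Proof.
move=> fg Ux; apply: near_eq_is_derive; near=> z; apply: fg.
by near: z; exact: near_open.
Unshelve. all: by end_near. Qed.

(** Here smoothness matters: mere existence of directional derivatives does not
    make them additive in the direction.  The increment along h (v + w) is cut
    at h v + x; by the mean value theorem the second piece is h times the
    derivative along w at a point that tends to x, where this derivative is
    continuous. *)
Lemma derive_dirD f x v w : smooth_on U f -> U x ->
  'D_(v + w) f x = 'D_v f x + 'D_w f x.
Proof.
move=> sf Ux.
suff : is_derive x (v + w) f ('D_w f x + 'D_v f x).
  by move=> ?; rewrite derive_val addrC.
apply/is_derive_cvg.
have /is_derive_cvg dv := derivableP (smooth_derivable (v:=v) sf Ux).
rewrite (_ : (fun h => _) = (fun h : R => h^-1 *: (f (h *: (v + w) + x) - f (h *: v + x))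
   + h^-1 *: (f (h *: v + x) - f x))); last first.
  by apply/funext => h; rewrite -scalerDr addrA subrK.
apply: cvgD dv.
apply/cvgrPdist_lt => e e0.
have /cvgrPdist_lt /(_ e e0) cw := smooth_continuous (smooth_derive w sf) Ux.
have /nbhs_ballP[d /= d0 dP] : nbhs x [set z | U z /\ `|'D_w f x - 'D_w f z| < e].
  by apply: filterI; [exact: near_open | exact: cw].
pose N := `|v| + `|w| + 1.
have N0 : 0 < N by rewrite ltr_wpDl // addr_ge0.
have hd0 : 0 < d / N by rewrite divr_gt0.
near=> h.
have h0 : h != 0 by near: h; exact: nbhs_dnbhs_neq.
have hd : `|h| < d / N by near: h; exact: dnbhs0_lt.
(* N and d / N are chosen so that the whole second piece stays in ball x d. *)
have inb (t : R) : 0 <= t <= 1 -> ball x d (t *: (h *: w) + (h *: v + x)).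
  move=> /andP[t0 t1]; rewrite -ball_normE /= addrA opprD addrCA subrr addr0.
  rewrite normrN (le_lt_trans (ler_normD _ _)) // !normrZ.
  move: hd; rewrite ltr_pdivlMr //; apply: le_lt_trans.
  rewrite /N !mulrDr mulr1 [leLHS]addrC -addrA lerD2l -[leLHS]addr0 lerD //.
  by rewrite ger0_norm // ler_piMl // mulr_ge0.
have [|t /andP[t0 t1]] := @segment_MVT R E f (h *: v + x) (h *: w).
  by move=> t /inb /dP[Uz _]; exact: smooth_derivable.
rewrite addrA -scalerDr [w + v]addrC => ->.
have /inb /dP[Uz Hz] : 0 <= t <= 1 by rewrite !ltW.
rewrite derive_dirZ; last exact: smooth_derivable.
by rewrite [_ *: _]mulKf.
Unshelve. all: by end_near. Qed.

Lemma derive_dir_sum f x (I : Type) (r : seq I) (P : pred I) (V : I -> E) :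
  smooth_on U f -> U x ->
  'D_(\sum_(i <- r | P i) V i) f x = \sum_(i <- r | P i) 'D_(V i) f x.
Proof.
move=> sf Ux; elim/big_ind2 : _ => //; first exact: derive0.
by move=> _ b _ d <- <-; exact: derive_dirD.
Qed.

Lemma derive_dirN f x v : smooth_on U f -> U x -> 'D_(- v) f x = - 'D_v f x.
Proof.
move=> sf Ux; rewrite -scaleN1r derive_dirZ ?mulN1r //.
exact: smooth_derivable.
Qed.

Lemma derive_dirZS f x v c : smooth_on U f -> U x -> 'D_(c *: v) f x = c * 'D_v f x.
Proof. by move=> sf Ux; apply: derive_dirZ; exact: smooth_derivable. Qed.

(** To prove smoothness, it suffices to find a class of continuous functions
    with all directional derivatives that is stable under these derivatives. *)
Lemma smooth_coind (P : (E -> R^o) -> Prop) :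
  (forall f x, P f -> U x ->
     {for x, continuous f} /\ forall v, derivable f x v) ->
  (forall f v, P f -> P ('D_v f)) ->
  forall f, P f -> smooth_on U f.
Proof.
move=> Preg Pder f Pf s x Ux; apply: Preg => //.
by elim: s => //= v s; exact: Pder.
Qed.

(** Expressions built from smooth functions form a class to which
    [smooth_coind] applies: the rules of differentiation stay inside it.  This
    gives all closure properties of smooth functions at once.  The last clause
    is needed because these rules only hold on U. *)
Inductive smooth_expr : (E -> R^o) -> Prop :=
| SmoothBase f : smooth_on U f -> smooth_expr f
| SmoothAdd f g : smooth_expr f -> smooth_expr g -> smooth_expr (fun x => f x + g x)
| SmoothMul f g : smooth_expr f -> smooth_expr g ->
    smooth_expr (fun x => f x * g x : R)
| SmoothInv f : smooth_expr f -> (forall x, U x -> f x != 0) ->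
    smooth_expr (fun x => (f x : R)^-1)
| SmoothEq f g : smooth_expr f -> (forall x, U x -> f x = g x) -> smooth_expr g.

Lemma smooth_on_cst (c : R) : smooth_on U (fun=> c : R^o).
Proof.
move=> s x _; suff [d ->] : exists d : R, iterated_derive s (fun=> c : R^o) = cst d.
  by split; [exact: cst_continuous | move=> v; exact: derivable_cst].
elim: s => [|v s [d /= ->]]; first by exists c.
by exists 0; apply/funext => z; rewrite derive_cst.
Qed.

Lemma smooth_expr_continuous f x : smooth_expr f -> U x -> {for x, continuous f}.
Proof.
move=> sf Ux; elim: sf => {f} [f sf|f g _ cf _ cg|f g _ cf _ cg|f _ cf f0|f g _ cf fg].
- exact: smooth_continuous.
- exact: continuousD.
- exact: continuousM.
- by apply: (@cvgV R E (nbhs x)) => //; exact: f0.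
- rewrite /prop_for /continuous_at -(fg x) //; apply: cvg_trans cf.
  apply: near_eq_cvg; near=> z; apply: fg.
  by near: z; exact: near_open.
Unshelve. all: by end_near. Qed.

Lemma smooth_expr_derivable f x v : smooth_expr f -> U x -> derivable f x v.
Proof.
move=> sf Ux; elim: sf => {f} [f sf|f g _ cf _ cg|f g _ cf _ cg|f _ cf f0|f g _ cf fg].
- exact: smooth_derivable.
- exact: derivableD.
- exact: derivableM.
- by apply: (@derivableV R E f) => //; exact: f0.
- apply: near_eq_derivable cf; near=> z; apply: fg.
  by near: z; exact: near_open.
Unshelve. all: by end_near. Qed.

Lemma smooth_expr_derive f v : smooth_expr f -> smooth_expr ('D_v f).
Proof.
move=> sf; elim: sf => {f} [f sf|f g sf df sg dg|f g sf df sg dg|f sf df f0|f g sf df fg].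
- by apply: SmoothBase; exact: smooth_derive.
- apply: (SmoothEq (SmoothAdd df dg)) => x Ux.
  by rewrite -deriveD //; exact: smooth_expr_derivable.
- apply: (SmoothEq (SmoothAdd (SmoothMul sf dg) (SmoothMul sg df))) => x Ux.
  by rewrite -[RHS]/('D_v (f * g : E -> R) x) deriveM //; exact: smooth_expr_derivable.
- apply: (SmoothEq (SmoothMul (SmoothMul (SmoothBase (smooth_on_cst (-1)))
      (SmoothMul (SmoothInv sf f0) (SmoothInv sf f0))) df)) => x Ux.
  rewrite (@deriveV R E f) ?f0 //; last exact: smooth_expr_derivable.
  by rewrite /= mulN1r /GRing.scale /= -exprVn expr2.
- by apply: (SmoothEq df) => x Ux; exact: eq_derive_open.
Qed.

Lemma smooth_exprP f : smooth_expr f -> smooth_on U f.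
Proof.
apply: smooth_coind => {}f; last exact: smooth_expr_derive.
move=> x sf Ux; split; first exact: smooth_expr_continuous.
by move=> v; exact: smooth_expr_derivable.
Qed.

Lemma smooth_on_eq f g : smooth_on U f -> (forall x, U x -> f x = g x) -> smooth_on U g.
Proof. by move=> sf fg; exact: smooth_exprP (SmoothEq (SmoothBase sf) fg). Qed.

Lemma smooth_onD f g : smooth_on U f -> smooth_on U g ->
  smooth_on U (fun x => f x + g x).
Proof. by move=> sf sg; exact: smooth_exprP (SmoothAdd (SmoothBase sf) (SmoothBase sg)). Qed.

Lemma smooth_onM f g : smooth_on U f -> smooth_on U g ->
  smooth_on U (fun x => f x * g x : R).
Proof. by move=> sf sg; exact: smooth_exprP (SmoothMul (SmoothBase sf) (SmoothBase sg)). Qed.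

Lemma smooth_onV f : smooth_on U f -> (forall x, U x -> f x != 0) ->
  smooth_on U (fun x => (f x : R)^-1).
Proof. by move=> sf f0; exact: smooth_exprP (SmoothInv (SmoothBase sf) f0). Qed.

Lemma smooth_onZ (c : R) f : smooth_on U f -> smooth_on U (fun x => c * f x : R).
Proof. by move=> sf; apply: smooth_onM sf; exact: smooth_on_cst. Qed.

Lemma smooth_onN f : smooth_on U f -> smooth_on U (fun x => - f x).
Proof.
move=> sf; apply: (smooth_on_eq (smooth_onZ (-1) sf)) => x _.
exact: mulN1r.
Qed.

Lemma smooth_on_sum (I : Type) (r : seq I) (P : pred I) (F : I -> E -> R^o) :
  (forall i, smooth_on U (F i)) -> smooth_on U (fun x => \sum_(i <- r | P i) F i x).
Proof.
move=> sF; elim: r => [|i r IH].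
  by apply: (smooth_on_eq (smooth_on_cst 0)) => x _; rewrite big_nil.
case Pi : (P i).
  by apply: (smooth_on_eq (smooth_onD (sF i) IH)) => x _; rewrite big_cons Pi.
by apply: (smooth_on_eq IH) => x _; rewrite big_cons Pi.
Qed.

Lemma smooth_on_prod (I : Type) (r : seq I) (P : pred I) (F : I -> E -> R^o) :
  (forall i, smooth_on U (F i)) -> smooth_on U (fun x => \prod_(i <- r | P i) (F i x : R)).
Proof.
move=> sF; elim: r => [|i r IH].
  by apply: (smooth_on_eq (smooth_on_cst 1)) => x _; rewrite big_nil.
case Pi : (P i).
  by apply: (smooth_on_eq (smooth_onM (sF i) IH)) => x _; rewrite big_cons Pi.
by apply: (smooth_on_eq IH) => x _; rewrite big_cons Pi.
Qed.

Lemma smooth_onX f k : smooth_on U f -> smooth_on U (fun x => (f x : R) ^+ k).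
Proof.
move=> sf; elim: k => [|k IH]; first exact: smooth_on_cst.
by apply: (smooth_on_eq (smooth_onM sf IH)) => x _; rewrite exprS.
Qed.

End SmoothFunctions.

(** A function that is its own derivative, in the sense of linear maps: its
    directional derivatives are constant functions. *)
Lemma smooth_linear (R : realType) (E : normedModType R) (W : set E) (f : E -> R^o) :
  continuous f -> (forall x v, is_derive x v f (f v)) -> smooth_on W f.
Proof.
move=> cf df.
apply: (@smooth_coind R E W (fun g => g = f \/ exists c : R, g = cst c)); last by left.
- move=> g x [->|[c ->]] _; first by split=> [|v]; [exact: cf | have [] := df x v].
  by split=> [|v]; [exact: cst_continuous | exact: derivable_cst].
- move=> g v [->|[c ->]]; right.
    by exists (f v); apply/funext => x; have [_] := df x v.
  by exists 0; apply/funext => x; rewrite derive_cst.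
Qed.

Lemma is_derive_linear (R : realType) (E W : normedModType R) (f : E -> W) x v :
  (forall u w : E, f (u + w) = f u + f w) -> (forall (c : R) w, f (c *: w) = c *: f w) ->
  is_derive x v f (f v).
Proof.
move=> fD fZ; apply/is_derive_cvg; apply: cvg_near_cst; near=> h.
rewrite fD addrK fZ scalerA mulVf ?scale1r //.
by near: h; exact: nbhs_dnbhs_neq.
Unshelve. all: by end_near. Qed.

(** Entries commute with iterated derivatives, but only at the points of U,
    hence the class of functions that agree on U with an entry of some
    iterated derivative. *)
Lemma smooth_mx_entry (R : realType) (E : normedModType R) (m n : nat) (U : set E)
    (g : E -> 'M[R]_(m, n)) i j :
  open U -> smooth_on U g -> smooth_on U (fun x => g x i j : R^o).
Proof.
move=> oU sg.
apply: (@smooth_coind R E U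
  (fun h => exists s, forall x, U x -> h x = iterated_derive s g x i j)); last by exists [::].
- move=> h x [s hE] Ux; have [cs ds] := sg s x Ux.
  have nh : \forall z \near x, (iterated_derive s g z i j : R^o) = h z.
    by near=> z; apply/esym/hE; near: z; exact: near_open.
  split=> [|v].
    rewrite /prop_for /continuous_at hE //.
    have : iterated_derive s g z i j @[z --> x] --> (iterated_derive s g x i j : R^o).
      apply: (@continuous_comp _ _ _ (iterated_derive s g) (fun A : 'M[R]_(m, n) => A i j) x) => //.
      exact: coord_continuous.
    by apply: cvg_trans; exact: near_eq_cvg.
  apply: near_eq_derivable nh _.
  by have /derivable_mxP := ds v; exact.
- move=> h v [s hE]; exists (v :: s) => x Ux /=.
  have [_ ds] := sg s x Ux.
  rewrite (derive_mx (ds v)) mxE.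
  exact: (@eq_derive_open _ _ _ oU).
Unshelve. all: by end_near. Qed.

(** * Smooth maps are locally Lipschitz *)

Lemma rV_entry_le_norm (R : realType) m (x : 'rV[R]_m) i : `|x 0 i| <= `|x|.
Proof.
rewrite [leRHS]/Num.Def.normr /= mx_normrE.
by apply: le_trans; last exact: (le_bigmax _ _ (0, i)).
Qed.

Lemma rV_norm_le (R : realType) m (x : 'rV[R]_m) (C : R) : 0 <= C ->
  (forall i, `|x 0 i| <= C) -> `|x| <= C.
Proof.
move=> C0 xC; rewrite [leLHS]/Num.Def.normr /= mx_normrE.
by apply: bigmax_le => // -[i j] _ /=; rewrite ord1.
Qed.

(** The derivatives along the finitely many basis vectors are bounded near z0
    by continuity, so the derivative along w is bounded by a multiple of the
    norm of w; the mean value theorem on segments concludes. *)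
Lemma smooth_locally_lipschitz (R : realType) (E : normedModType R) (I : finType)
    (e : I -> E) (U : set E) (f : E -> R^o) (z0 : E) :
  (forall w : E, exists2 c : I -> R, forall i, `|c i| <= `|w| &
    w = \sum_i c i *: e i) ->
  open U -> smooth_on U f -> U z0 ->
  exists r K : R, [/\ 0 < r, 0 <= K & forall z z', `|z - z0| < r -> `|z' - z0| < r ->
    U z /\ `|f z - f z'| <= K * `|z - z'|].
Proof.
move=> basis openU sf Uz0.
pose C i := `|'D_(e i) f z0| + 1.
have /nbhs_ballP[r /= r0 rP] : nbhs z0 [set z | U z /\ forall i, `|'D_(e i) f z| <= C i].
  apply: filterI; first exact: near_open.
  apply: filter_forall => i.
  have /cvgrPdist_lt /(_ 1 ltr01) := smooth_continuous (smooth_derive (e i) sf) Uz0.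
  apply: filterS => z /= zP; rewrite /C -[X in `|X|](subrK ('D_(e i) f z0)) addrC.
  by rewrite (le_trans (ler_normD _ _)) // lerD // distrC ltW.
have C0 i : 0 <= C i by rewrite addr_ge0.
exists r, (\sum_i C i); split => //; first exact: sumr_ge0.
move=> z z' zr z'r.
have inb (t : R) : 0 <= t <= 1 -> ball z0 r (t *: (z - z') + z').
  move=> /andP[t0 t1]; rewrite -ball_normE /= distrC.
  (* Balls are convex. *)
  have -> : t *: (z - z') + z' - z0 = t *: (z - z0) + (1 - t) *: (z' - z0).
    rewrite scalerBl scale1r [RHS]addrCA -scalerBr opprB [z - z0 + _]addrA subrK.
    by rewrite -addrA addrC.
  apply: (le_lt_trans (ler_normD _ _)); rewrite !normrZ !ger0_norm // ?subr_ge0 //.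
  have [->|tn1] := eqVneq t 1; first by rewrite subrr mul0r mul1r addr0.
  rewrite -[ltRHS]mul1r -[X in X * r](subrK t) addrC [ltRHS]mulrDl.
  rewrite ltr_leD //; last by rewrite ler_wpM2l // ltW.
  by rewrite ltr_pM2l // subr_gt0 lt_neqAle tn1.
have Uz : U z.
  have /rP[+ _] : ball z0 r (1 *: (z - z') + z') by apply: inb; rewrite ler01 /=.
  by rewrite scale1r subrK.
split => //.
have [|t /andP[t0 t1]] := @segment_MVT R E f z' (z - z').
  by move=> t /inb /rP[Ut _]; exact: (smooth_derivable sf Ut).
rewrite subrK => ->.
have /inb /rP[Ut Ht] : 0 <= t <= 1 by rewrite !ltW.
have [c cP cE] := basis (z - z').
rewrite [X in 'D_X _ _]cE (derive_dir_sum openU) // mulr_suml.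
apply: (le_trans (ler_norm_sum _ _ _)); apply: ler_sum => i _.
rewrite (derive_dirZS _ _ sf) // normrM mulrC.
by apply: ler_pM.
Qed.

Section Plane.
Context (R : realType) (n : nat).
Local Notation V := 'rV[R]_n.
Implicit Types (g : V * V -> R^o) (x y v w : V).

Lemma derive_fst g x y v : 'D_v (fun z => g (z, y)) x = 'D_((v, 0) : V * V) g (x, y).
Proof.
have gE : (fun h : R => h^-1 *: (((fun z => g (z, y)) \o shift x) (h *: v) - g (x, y))) =
    (fun h => h^-1 *: ((g \o shift (x, y)) (h *: ((v, 0) : V * V)) - g (x, y))).
  apply/funext => h /=; congr (_ *: (g _ - _)).
  by rewrite /GRing.scale /= /scale_pair /= [RHS]/GRing.add /= /add_pair /= scaler0 add0r.
by rewrite /derive gE.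
Qed.

Lemma derive_snd g x y v : 'D_v (fun z => g (x, z)) y = 'D_((0, v) : V * V) g (x, y).
Proof.
have gE : (fun h : R => h^-1 *: (((fun z => g (x, z)) \o shift y) (h *: v) - g (x, y))) =
    (fun h => h^-1 *: ((g \o shift (x, y)) (h *: ((0, v) : V * V)) - g (x, y))).
  apply/funext => h /=; congr (_ *: (g _ - _)).
  by rewrite /GRing.scale /= /scale_pair /= [RHS]/GRing.add /= /add_pair /= scaler0 add0r.
by rewrite /derive gE.
Qed.

Definition tangent_basis (i : 'I_n + 'I_n) : V * V :=
  match i with inl i => (delta_mx 0 i, 0) | inr i => (0, delta_mx 0 i) end.

Lemma tangent_basisP (w : V * V) : exists2 c : 'I_n + 'I_n -> R,
  forall i, `|c i| <= `|w| & w = \sum_i c i *: tangent_basis i.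
Proof.
exists (fun i => match i with inl i => w.1 0 i | inr i => w.2 0 i end).
  move=> [i|i]; rewrite [leRHS]/Num.Def.normr /= le_max rV_entry_le_norm ?orbT //.
rewrite big_sumType /=.
have pairE (r : seq 'I_n) (a b : 'I_n -> R) :
    (\sum_(i <- r) a i *: tangent_basis (inl i) +
     \sum_(i <- r) b i *: tangent_basis (inr i)) =
    (\sum_(i <- r) a i *: delta_mx 0 i, \sum_(i <- r) b i *: delta_mx 0 i).
  elim: r => [|i r IH]; first by rewrite !big_nil addr0.
  rewrite !big_cons addrACA IH /= ![in LHS]/GRing.scale /= /scale_pair /=.
  by rewrite ![in LHS]/GRing.add /= /add_pair /= !scaler0 addr0 add0r.
by rewrite pairE; case: w => x y /=; congr (_, _); exact: row_sum_delta.
Qed.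

End Plane.

(** * The Picard-Lindelof theorem *)

Lemma lipschitz_continuous (R : realType) (V W : normedModType R) (f : V -> W) (K : R) : 0 <= K ->
  (forall x y, `|f x - f y| <= K * `|x - y|) -> continuous f.
Proof.
move=> K0 fK x; apply/cvgrPdist_lt => e e0.
have K1 : 0 < K + 1 by rewrite ltr_wpDl.
have e1 : 0 < e / (K + 1) by rewrite divr_gt0.
near=> y.
rewrite (le_lt_trans (fK _ _)) //.
apply: (@le_lt_trans _ _ ((K + 1) * `|x - y|)); first by rewrite ler_wpM2r // lerDl.
rewrite mulrC -ltr_pdivlMr //; by near: y.
Unshelve. all: by end_near. Qed.

Section Picard.
Context (R : realType).

(** The integral from -1 is differentiable inside ]-1, 1[ by the fundamental
    theorem of calculus, then normalized to vanish at 0. *)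
Lemma antiderivative (f : R -> R) : continuous f ->
  exists2 F : R -> R, F 0 = 0 & forall t : R, -1 < t < 1 -> is_derive t 1 F (f t).
Proof.
move=> cf.
have intf : (@lebesgue_measure R).-integrable `[(-1), 1] (EFin \o f).
  apply: continuous_compact_integrable; first exact: segment_compact.
  exact: continuous_subspaceT.
pose F y := (\int[@lebesgue_measure R]_(t in [set` `[(-1), y]]) f t)%R.
exists (fun y => F y - F 0); first by rewrite subrr.
move=> t /andP[t0 t1].
have [dF F'E] := continuous_FTC1_closed t1 intf t0 (cf t).
have dFt : is_derive t 1 F (f t) by split; [exact: dF | rewrite -derive1E F'E].
by rewrite -[f t]subr0; apply: is_deriveB.
Qed.

Lemma antiderivative_rV m (g : R -> 'rV[R]_m) : continuous g ->
  exists2 G : R -> 'rV[R]_m, G 0 = 0 &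
    forall t : R, -1 < t < 1 -> is_derive t 1 G (g t).
Proof.
move=> cg.
have cgi i : continuous (fun t => g t 0 i).
  move=> t; apply: (@continuous_comp _ _ _ g (fun x : 'rV[R]_m => x 0 i) t).
    exact: cg.
  exact: coord_continuous.
have /choice[G GP] : forall i, exists F : R -> R, F 0 = 0 /\
    forall t : R, -1 < t < 1 -> is_derive t 1 F (g t 0 i).
  by move=> i; have [F F0 dF] := antiderivative (cgi i); exists F.
exists (fun t => \row_i G i t); first by apply/rowP => i; rewrite !mxE (GP i).1.
move=> t tI.
have dG : derivable (fun t => \row_i G i t) t 1.
  apply/derivable_mxP => i j.
  have [dGj _] := (GP j).2 t tI.
  by rewrite (_ : (fun x => _) = G j) //; apply/funext => s; rewrite mxE.
split => //; rewrite derive_mx //; apply/matrixP => i j; rewrite mxE ord1.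
rewrite (_ : (fun x => _) = G j); last by apply/funext => s; rewrite mxE.
by have [_ ->] := (GP j).2 t tI.
Qed.

Lemma is_derive_entry m (G : R -> 'rV[R]_m) (t : R) (g : 'rV[R]_m) i :
  is_derive t 1 G g -> is_derive t 1 (fun s => G s 0 i) (g 0 i).
Proof.
move=> [dG gE]; split; first by move/derivable_mxP : dG; exact.
by rewrite -gE derive_mx // mxE.
Qed.

Lemma bounded_derivative_lipschitz m (G g : R -> 'rV[R]_m) (a b C : R) : 0 <= C ->
  (forall t : R, a < t < b -> is_derive t 1 G (g t)) ->
  (forall t, a < t < b -> `|g t| <= C) ->
  forall t s, a < t < b -> a < s < b -> `|G t - G s| <= C * `|t - s|.
Proof.
move=> C0 dG gC t s.
wlog st : t s / s <= t.
  move=> H tI sI; have [st|/ltW ts] := leP s t; first exact: H.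
  by rewrite distrC (distrC t); exact: H.
move=> /andP[ta tb] /andP[sa sb].
apply: rV_norm_le => [|i]; first exact: mulr_ge0.
rewrite !mxE.
have inI u : s <= u <= t -> a < u < b.
  by move=> /andP[su ut]; rewrite (lt_le_trans sa) //= (le_lt_trans ut).
have [u||u + ->] := @MVT_segment R (fun u => G u 0 i) (fun u => g u 0 i) s t st.
- rewrite in_itv /= => /andP[/ltW su /ltW ut]; apply: is_derive_entry; apply: dG.
  by apply: inI; rewrite su.
- apply: derivable_within_continuous => u; rewrite in_itv /= => /inI /dG dGu.
  by have [] := is_derive_entry i dGu.
- rewrite in_itv /= => /inI uI; rewrite normrM ler_wpM2r //.
  apply: le_trans (gC u uI).
  exact: rV_entry_le_norm.
Qed.

Lemma exp_half_small (D e : R) : 0 < e -> exists k : nat, D * 2^-1 ^+ k < e.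
Proof.
move=> e0; have [k kP] : exists k : nat, D / e < k%:R.
  by exists (Num.bound `|D / e|); exact: le_lt_trans (ler_norm _) (archi_boundP (normr_ge0 _)).
exists k; rewrite exprVn ltr_pdivrMr ?exprn_gt0 // mulrC -ltr_pdivrMr //.
apply: lt_le_trans kP _; rewrite -natrX ler_nat.
by apply: ltnW; exact: ltn_expl.
Qed.

(** The form in which completeness is used: increments dominated by a geometric
    sequence, with a bound on the distance to the limit. *)
Lemma geometric_limit m (u : nat -> 'rV[R]_m) (C : R) :
  0 <= C -> (forall k, `|u k.+1 - u k| <= C * 2^-1 ^+ k) ->
  exists l, forall k, `|u k - l| <= C * 2 * 2^-1 ^+ k.
Proof.
move=> C0 uC.
have uD k j : `|u (k + j)%N - u k| <= C * 2 * (2^-1 ^+ k - 2^-1 ^+ (k + j)).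
  elim: j => [|j IH]; first by rewrite addn0 !subrr normr0 mulr0.
  rewrite -(subrK (u (k + j)%N) (u (k + j.+1)%N)) -addrA (le_trans (ler_normD _ _)) //.
  rewrite addnS (le_trans (lerD (uC _) IH)) // exprS.
  set q := 2^-1 ^+ (k + j); rewrite le_eqVlt; apply/orP; left; apply/eqP; by field.
have uT k j : `|u (k + j)%N - u k| <= C * 2 * 2^-1 ^+ k.
  rewrite (le_trans (uD k j)) // ler_wpM2l ?mulr_ge0 // gerBl.
  by rewrite exprn_ge0 // invr_ge0.
have cu : cvgn u.
  apply/cauchy_cvgP; apply: cauchy_exP => e e0.
  have [k kP] := exp_half_small (C * 2) e0.
  exists (u k); exists k => // j /= kj; rewrite -ball_normE /= distrC.
  by rewrite -(subnKC kj) (le_lt_trans (uT _ _)).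
exists (limn u) => k; apply/ler_addgt0Pr => e e0.
have /cvgrPdist_lt /(_ e e0) [N _ NP] : u @ \oo --> limn u by [].
have := NP (k + N)%N (leq_addl _ _); rewrite /= => lP.
rewrite -(subrK (u (k + N)%N) (u k)) -addrA (le_trans (ler_normD _ _)) //.
by rewrite lerD //; [rewrite distrC | rewrite distrC ltW].
Qed.

(** Used both to freeze time and to retract a neighborhood in phase space. *)
Definition clamp (a b t : R) : R := Num.max a (Num.min b t).

Lemma clamp_itv a b t : a <= b -> a <= clamp a b t <= b.
Proof. by move=> ab; rewrite /clamp le_max lexx /= ge_max ab ge_min lexx. Qed.

Lemma clamp_id a b t : a <= t <= b -> clamp a b t = t.
Proof. by move=> /andP[at_ tb]; rewrite /clamp (min_idPr tb) (max_idPr at_). Qed.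

Lemma clamp_lipschitz a b t s : `|clamp a b t - clamp a b s| <= `|t - s|.
Proof.
wlog st : t s / s <= t.
  by move=> H; have [/H//|/ltW /H] := leP s t; rewrite distrC (distrC s).
have mono : clamp a b s <= clamp a b t.
  by rewrite /clamp le_max2 // le_min2.
rewrite !ger0_norm ?subr_ge0 // /clamp.
by case: (leP b s) => ?; case: (leP b t) => ?; case: (leP a b) => ?;
  case: (leP a s) => ?; case: (leP a t) => ?; lra.
Qed.

(** The Picard operator T g = z0 + integral of g, on ]-h, h[.  It is extended to
    all times by freezing it outside of [-h, h], so that its iterates are
    functions on R with estimates uniform in time. *)
Lemma integral_operator m (z0 : 'rV[R]_m) (h : R) : 0 < h -> h < 1 ->
  exists T : (R -> 'rV[R]_m) -> R -> 'rV[R]_m, forall g : R -> 'rV[R]_m, continuous g ->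
  [/\ T g 0 = z0,
    forall t : R, - h < t < h -> is_derive t 1 (T g) (g t),
    forall C : R, (forall t, `|g t| <= C) -> forall t s, `|T g t - T g s| <= C * `|t - s|,
    forall C : R, (forall t, `|g t| <= C) -> forall t, `|T g t - z0| <= h * C &
    forall g' : R -> 'rV[R]_m, continuous g' -> forall C : R, (forall t, `|g t - g' t| <= C) ->
      forall t, `|T g t - T g' t| <= h * C].
Proof.
move=> h0 h1.
have /choice[Y YP] : forall g : R -> 'rV[R]_m, exists Y : R -> 'rV[R]_m, continuous g ->
    Y 0 = 0 /\ forall t : R, -1 < t < 1 -> is_derive t 1 Y (g t).
  move=> g; case: (pselect (continuous g)) => [/antiderivative_rV[Y Y0 dY]|ng].
    by exists Y.
  by exists 0 => /ng.
pose cl := clamp (- h) h.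
have hh : - h <= h by rewrite ge0_cp // ltW.
have clI (t : R) : -1 < cl t < 1.
  have /andP[a b] := clamp_itv t hh.
  by rewrite (lt_le_trans _ a) ?ltrN2 //= (le_lt_trans b).
have cl0 : cl 0 = 0 by apply: clamp_id; rewrite oppr_le0 ltW.
have clh (t : R) : `|cl t| <= h by rewrite ler_norml; exact: clamp_itv.
exists (fun g t => z0 + Y g (cl t)) => g cg.
have [Y0 dY] := YP g cg.
have C0 (f : R -> 'rV[R]_m) (C : R) : (forall t, `|f t| <= C) -> 0 <= C.
  by move=> /(_ 0); exact: le_trans.
have lipY (C : R) : (forall t, `|g t| <= C) -> forall t s,
    `|Y g (cl t) - Y g (cl s)| <= C * `|cl t - cl s|.
  move=> gC t s; apply: (bounded_derivative_lipschitz (C0 _ _ gC) dY) => //.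
split.
- by rewrite cl0 Y0 addr0.
- move=> t /andP[th ht].
  have dYt : is_derive t 1 (fun s => z0 + Y g s) (g t).
    rewrite -[g t]add0r; apply: is_deriveD; apply: dY.
    by rewrite (lt_trans _ th) ?ltrN2 //= (lt_trans ht).
  apply: near_eq_is_derive dYt; near=> s; congr (z0 + Y g _); apply/esym/clamp_id.
  have : s \in `]- h, h[ by near: s; apply: near_in_itvoo; rewrite in_itv /= th.
  by rewrite in_itv /= => /andP[/ltW -> /ltW].
- move=> C gC t s; rewrite opprD addrACA subrr add0r (le_trans (lipY C gC t s)) //.
  by rewrite ler_wpM2l ?(C0 _ _ gC) // clamp_lipschitz.
- move=> C gC t; rewrite addrAC subrr add0r -[Y g _]subr0 -Y0 -cl0.
  rewrite (le_trans (lipY C gC t 0)) // cl0 subr0 mulrC ler_wpM2r ?(C0 _ _ gC) //.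
- move=> g' cg' C gC t; have [Y'0 dY'] := YP g' cg'.
  rewrite opprD addrACA subrr add0r.
  have dD (s : R) : -1 < s < 1 -> is_derive s 1 (fun s => Y g s - Y g' s) (g s - g' s).
    by move=> sI; apply: is_deriveB; [exact: dY | exact: dY'].
  have := bounded_derivative_lipschitz (C0 _ _ gC) dD (fun s _ => gC s) (clI t) (clI 0).
  rewrite cl0 Y0 Y'0 subrr !subr0 => /le_trans -> //.
  by rewrite mulrC ler_wpM2r ?(C0 _ _ gC).
Unshelve. all: by end_near. Qed.

(** For h K <= 1/2 the map z |-> T (f o z) halves uniform distances, so its
    iterates from a constant converge geometrically; the limit is Lipschitz
    with the constant B of the iterates, hence continuous, and is a fixed
    point. *)
Lemma picard_global m (f : 'rV[R]_m -> 'rV[R]_m) (K B : R) (z0 : 'rV[R]_m) :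
  0 <= K -> (forall z, `|f z| <= B) ->
  (forall z z', `|f z - f z'| <= K * `|z - z'|) ->
  exists h : R, exists z : R -> 'rV[R]_m, [/\ 0 < h, z 0 = z0, continuous z &
    forall t : R, - h < t < h -> is_derive t 1 z (f (z t))].
Proof.
move=> K0 fB fK.
have B0 : 0 <= B by exact: le_trans (fB z0).
pose h := (2 * (K + 1))^-1.
have K1 : 0 < 2 * (K + 1) by rewrite mulr_gt0 // ltr_wpDl.
have h0 : 0 < h by rewrite invr_gt0.
have h1 : h < 1 by rewrite invf_lt1 //; lra.
have hK : h * K <= 2^-1.
  by rewrite /h invfM -mulrA ler_piMr // mulrC ler_pdivrMr ?ltr_wpDl // mul1r lerDl.
have cf : continuous f by exact: lipschitz_continuous fK.
have [T TP] := integral_operator z0 h0 h1.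
pose zs := fix zs k := if k is k.+1 then T (f \o zs k) else cst z0.
have czs k : continuous (zs k).
  elim: k => [|k IH]; first exact: cst_continuous.
  have cfz : continuous (f \o zs k).
    by move=> t; apply: continuous_comp; [exact: IH | exact: cf].
  have [_ _ lipT _ _] := TP _ cfz.
  exact: lipschitz_continuous B0 (lipT B (fun t => fB _)).
have cfzs k : continuous (f \o zs k).
  by move=> t; apply: continuous_comp; [exact: czs | exact: cf].
have zsB k t s : `|zs k t - zs k s| <= B * `|t - s|.
  case: k => [|k]; first by rewrite /= subrr normr0 mulr_ge0.
  have [_ _ lipT _ _] := TP _ (cfzs k).
  exact: lipT B (fun t => fB _) t s.
pose C := h * B.
have C0 : 0 <= C by rewrite mulr_ge0 // ltW.
have zsD k t : `|zs k.+1 t - zs k t| <= C * 2^-1 ^+ k.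
  elim: k t => [|k IH] t.
    have [_ _ _ Tz0 _] := TP _ (cfzs 0).
    by rewrite expr0 mulr1; exact: Tz0 B (fun t => fB _) t.
  have [_ _ _ _ TD] := TP _ (cfzs k.+1).
  have /(_ t)/le_trans -> // := TD _ (cfzs k) (K * (C * 2^-1 ^+ k))
    (fun t => le_trans (fK _ _) (ler_wpM2l K0 (IH t))).
  by rewrite mulrA exprS [leRHS]mulrCA ler_wpM2r // mulr_ge0 // exprn_ge0.
have /choice[z zP] : forall t, exists l, forall k, `|zs k t - l| <= C * 2 * 2^-1 ^+ k.
  by move=> t; exact: (@geometric_limit m (fun k => zs k t) C C0 (zsD^~ t)).
have zB t s : `|z t - z s| <= B * `|t - s|.
  apply/ler_addgt0Pr => e e0.
  have [k kP] := exp_half_small (C * 2 + C * 2) e0.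
  have -> : z t - z s = (zs k t - zs k s) + ((z t - zs k t) + (zs k s - z s)).
    by apply/rowP => i; rewrite !mxE; ring.
  rewrite (le_trans (ler_normD _ _)) // lerD //.
  apply: le_trans (ltW kP); rewrite mulrDl (le_trans (ler_normD _ _)) // lerD //.
  by rewrite distrC.
have cz : continuous z by exact: lipschitz_continuous zB.
(* Continuity of the limit comes before the fixed point equation, because the
   estimates on T are for continuous functions. *)
have cfz : continuous (f \o z).
  by move=> t; apply: continuous_comp; [exact: cz | exact: cf].
have [Tz0 dT _ _ TD] := TP _ cfz.
have Tz : T (f \o z) = z.
  apply/funext => t; apply/eqP; rewrite -subr_eq0 -normr_le0.
  apply/ler_addgt0Pr => e e0; rewrite add0r.
  have [k kP] := exp_half_small (h * (K * (C * 2)) + C) e0.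
  apply: le_trans (ltW kP); rewrite -(subrK (zs k.+1 t) (T (f \o z) t)) -addrA.
  rewrite (le_trans (ler_normD _ _)) // mulrDl lerD //.
    have -> : h * (K * (C * 2)) * 2^-1 ^+ k = h * (K * (C * 2 * 2^-1 ^+ k)) by ring.
    apply: (TD _ (cfzs k) (K * (C * 2 * 2^-1 ^+ k))) => s.
    by rewrite (le_trans (fK _ _)) // ler_wpM2l // distrC.
  rewrite (le_trans (zP t k.+1)) // exprS mulrA -(mulrA C) divff ?mulr1 //.
exists h, z; split => //; first by rewrite -Tz.
by move=> t /dT; rewrite Tz.
Qed.

End Picard.

(** * Second-order equations *)

(** The minimum of the radii and the sum of the constants of the components. *)
Lemma smooth_field_lipschitz (R : realType) (n m : nat)
    (W : set ('rV[R]_n * 'rV[R]_n)) (G : 'rV[R]_n * 'rV[R]_n -> 'rV[R]_m) z0 :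
  open W -> (forall i, smooth_on W (fun z => G z 0 i : R^o)) -> W z0 ->
  exists r K : R, [/\ 0 < r, 0 <= K &
    forall z z', `|z - z0| < r -> `|z' - z0| < r ->
      W z /\ `|G z - G z'| <= K * `|z - z'|].
Proof.
move=> openW sG Wz0.
have /choice[rK rKP] : forall i, exists rK : R * R, [/\ 0 < rK.1, 0 <= rK.2 &
    forall z z', `|z - z0| < rK.1 -> `|z' - z0| < rK.1 ->
      W z /\ `|G z 0 i - G z' 0 i| <= rK.2 * `|z - z'|].
  move=> i; have [r [K [? ? ?]]] :=
    smooth_locally_lipschitz (@tangent_basisP R n) openW (sG i) Wz0.
  by exists (r, K).
have /nbhs_ballP[r0 /= r00 r0P] : nbhs z0 W by apply: open_nbhs_nbhs.
pose r := \big[Num.min/r0]_i (rK i).1; pose K := \sum_i (rK i).2.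
have K0 : 0 <= K by apply: sumr_ge0 => i _; have [] := rKP i.
exists r, K; split=> //.
  by apply/bigmin_gtP; split => // i _; have [] := rKP i.
move=> z z' zr z'r; split.
  by apply: r0P; rewrite -ball_normE /= distrC (lt_le_trans zr) // bigmin_le_id.
apply: rV_norm_le => [|i]; first by rewrite mulr_ge0.
have [r0i Ki rKPi] := rKP i.
have [||_ Gi] := rKPi z z'.
- by rewrite (lt_le_trans zr) // bigmin_le_cond.
- by rewrite (lt_le_trans z'r) // bigmin_le_cond.
rewrite !mxE (le_trans Gi) // ler_wpM2r // /K (bigD1 i) //= lerDl.
by apply: sumr_ge0 => j _; have [] := rKP j.
Qed.

Section SecondOrderODE.
Context (R : realType) (n : nat).
Local Notation V := 'rV[R]_n.

Lemma open_slit_tangent (U : set V) : open U ->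
  open [set z : V * V | U z.1 /\ z.2 != 0].
Proof.
move=> openU.
have o1 : open ((@fst V V) @^-1` U).
  by apply: open_comp => // z _; exact: cvg_fst.
have o2 : open ((@snd V V) @^-1` [set y | y != 0]).
  apply: open_comp => [z _|]; first exact: cvg_snd.
  rewrite (_ : [set y : V | y != 0] = ~` [set 0]); first by apply: closed_openC; apply: accessible_closed_set1; apply: hausdorff_accessible; exact: norm_hausdorff.
  by apply/seteqP; split => y /= /eqP.
exact: openI.
Qed.

(** The equation u'' = G (u, u') is the first-order system for z = (u, u'),
    encoded as row vectors of size n + n.  The field is only Lipschitz on a
    ball of radius r around the initial condition z0; it is made globally
    Lipschitz and bounded by composing it with the coordinatewise retraction
    rho onto the cube of half-side r / 2, which does not change it near z0. *)
Lemma second_order_solution (U : set V) (G : V * V -> V) (x y : V) :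
  open U -> U x -> y != 0 ->
  (forall i, smooth_on [set z : V * V | U z.1 /\ z.2 != 0] (fun z => G z 0 i : R^o)) ->
  exists h : R, exists u : R -> V, [/\ 0 < h, u 0 = x, derive1 u 0 = y &
    forall t : R, - h < t < h ->
    [/\ U (u t), derivable u t 1, derivable (derive1 u) t 1, derive1 u t != 0 &
      derive1 (derive1 u) t = G (u t, derive1 u t)]].
Proof.
move=> openU Ux y0 sG.
have openW := open_slit_tangent openU.
have [r [K [r0 K0 lip]]] := smooth_field_lipschitz openW sG (conj Ux y0 : _ (x, y)).
pose J (z : 'rV[R]_(n + n)) : V * V := (lsubmx z, rsubmx z).
(* An opaque copy of row_mx x y, which must not be unfolded entrywise. *)
have [z0 z0E] : {z0 | z0 = row_mx x y} by exists (row_mx x y).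
have Jz0 : J z0 = (x, y) by rewrite /J z0E row_mxKl row_mxKr.
have JB z z' : `|J z - J z'| <= `|z - z'|.
  rewrite [leLHS]/Num.Def.normr /= ge_max.
  by apply/andP; split; apply: rV_norm_le => // i; rewrite !mxE;
    apply: le_trans (rV_entry_le_norm _ _); rewrite !mxE.
pose rho (z : 'rV[R]_(n + n)) : 'rV[R]_(n + n) :=
  \row_i clamp (z0 0 i - r / 2) (z0 0 i + r / 2) (z 0 i).
have rhoB z z' : `|rho z - rho z'| <= `|z - z'|.
  apply: rV_norm_le => // i; rewrite !mxE (le_trans (clamp_lipschitz _ _ _ _)) //.
  by apply: le_trans (rV_entry_le_norm _ i); rewrite !mxE.
have rhor z : `|rho z - z0| < r.
  apply: (@le_lt_trans _ _ (r / 2)); last by rewrite ltr_pdivrMr // ltr_pMr // ltr1n.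
  apply: rV_norm_le => [|i]; first by rewrite divr_ge0 // ltW.
  have ab : z0 0 i - r / 2 <= z0 0 i + r / 2 by lra.
  have /andP[c1 c2] := clamp_itv (z 0 i) ab.
  by rewrite !mxE ler_norml; apply/andP; split; lra.
have rho_id z : `|z - z0| <= r / 2 -> rho z = z.
  move=> zz; apply/rowP => i; rewrite mxE clamp_id //.
  have : `|z 0 i - z0 0 i| <= r / 2.
    apply: le_trans zz; apply: le_trans (rV_entry_le_norm _ i).
    by rewrite !mxE.
  by rewrite ler_norml => /andP[? ?]; lra.
have Jr z : `|J (rho z) - (x, y)| < r.
  by rewrite -Jz0 (le_lt_trans (JB _ _)).
pose f (z : 'rV[R]_(n + n)) := row_mx (J (rho z)).2 (G (J (rho z))).
have fK z z' : `|f z - f z'| <= (1 + K) * `|rho z - rho z'|.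
  apply: rV_norm_le => [|i]; first by rewrite mulr_ge0 // addr_ge0.
  have [_ GJ] := lip _ _ (Jr z) (Jr z').
  rewrite !mxE; case: splitP => j _; rewrite mulrDl mul1r.
    rewrite -[leLHS]addr0 lerD ?mulr_ge0 //.
    by apply: le_trans (rV_entry_le_norm _ (rshift n j)); rewrite !mxE.
  rewrite -[leLHS]add0r lerD //.
  apply: (@le_trans _ _ `|G (J (rho z)) - G (J (rho z'))|).
    by apply: le_trans (rV_entry_le_norm _ j); rewrite !mxE.
  by rewrite (le_trans GJ) // ler_wpM2l.
have K1 : 0 <= 1 + K by rewrite addr_ge0.
have fB z : `|f z| <= `|f z0| + (1 + K) * r.
  rewrite -(subrK (f z0) (f z)) addrC (le_trans (ler_normD _ _)) // lerD //.
  rewrite (le_trans (fK _ _)) // ler_wpM2l // -[X in _ - X]/(rho z0).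
  by rewrite (rho_id z0) ?subrr ?normr0 ?divr_ge0 ?ltW.
have fL z z' : `|f z - f z'| <= (1 + K) * `|z - z'|.
  by rewrite (le_trans (fK _ _)) // ler_wpM2l.
have [h [z [h0 zz0 cz dz]]] := picard_global z0 K1 fB fL.
have [d d0 dP] : exists2 d : R, 0 < d & forall t, - d < t < d -> `|z t - z0| <= r / 2.
  have /cvgrPdist_le /(_ (r / 2)) := cz 0.
  rewrite divr_gt0 // => /(_ isT) /nbhs_ballP[d /= d0 dP].
  exists d => // t td; rewrite distrC -zz0; apply: dP.
  by rewrite -ball_normE /= sub0r normrN ltr_norml.
pose k := Num.min h d; have k0 : 0 < k by rewrite lt_min h0.
have inh (t : R) : - k < t < k -> - h < t < h /\ - d < t < d.
  move=> /andP[]; rewrite lt_min ltrNl lt_min => /andP[? ?] /andP[-> ->].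
  by rewrite !andbT !(ltrNl _ t).
pose u t := lsubmx (z t); pose w t := rsubmx (z t).
have duw (t : R) : - k < t < k -> is_derive t 1 u (w t) /\ is_derive t 1 w (G (u t, w t)).
  move=> /inh[/dz [dzt zE] /dP/rho_id zt].
  have fzt : f (z t) = row_mx (w t) (G (u t, w t)) by rewrite /f zt.
  have /derivable_mxP dzij := dzt.
  have zij j : 'D_1 (fun s => z s 0 j) t = f (z t) 0 j by rewrite -zE derive_mx // mxE.
  split.
    have uE i : (fun s => u s 0 i) = (fun s => z s 0 (lshift n i)).
      by apply/funext => s; rewrite mxE.
    have du : derivable u t 1 by apply/derivable_mxP => i j; rewrite ord1 uE.
    split => //; rewrite derive_mx //; apply/rowP => i.
    by rewrite mxE uE zij fzt row_mxEl.
  have wE i : (fun s => w s 0 i) = (fun s => z s 0 (rshift n i)).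
    by apply/funext => s; rewrite mxE.
  have dw : derivable w t 1 by apply/derivable_mxP => i j; rewrite ord1 wE.
  split => //; rewrite derive_mx //; apply/rowP => i.
  by rewrite mxE wE zij fzt row_mxEr.
have u'E (t : R) : - k < t < k -> derive1 u t = w t.
  by move=> /duw[[_ uE] _]; rewrite derive1E.
have k00 : - k < 0 < k by rewrite ltrNl oppr0 k0.
exists k, u; split => //.
- by rewrite /u zz0 z0E row_mxKl.
- by rewrite u'E // /w zz0 z0E row_mxKr.
move=> t tk; have [[du uE] [dw wE]] := duw t tk.
have near_eq : \forall s \near t, w s = derive1 u s.
  near=> s; apply/esym/u'E.
  have : s \in `]- k, k[ by near: s; apply: near_in_itvoo; rewrite in_itv.
  by rewrite in_itv.
have [Ut wt0] : U (u t) /\ w t != 0.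
  have [Uw _] := lip _ _ (Jr (z t)) (Jr (z t)).
  by move: Uw; rewrite rho_id //; apply: dP; have [] := inh t tk.
split.
- exact: Ut.
- exact: du.
- exact: near_eq_derivable near_eq dw.
- by rewrite u'E.
- by rewrite derive1E -(near_eq_derive _ near_eq) wE u'E.
Unshelve. all: by end_near. Qed.

End SecondOrderODE.

(** * Straight lines and parallel acceleration *)

Section StraightLines.
Context (R : realType) (n : nat).
Local Notation V := 'rV[R]_n.

Lemma constant_of_zero_derivative (f : R -> R) (a b : R) :
  (forall t : R, a < t < b -> is_derive t 1 f 0) ->
  forall t s, a < t < b -> a < s < b -> f t = f s.
Proof.
move=> df t s.
wlog st : t s / s <= t.
  move=> H tI sI; have [st|/ltW ts] := leP s t; first exact: H.
  by apply/esym; exact: H.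
move=> /andP[ta tb] /andP[sa sb]; apply/eqP; rewrite -subr_eq0.
have inI u : s <= u <= t -> a < u < b.
  by move=> /andP[su ut]; rewrite (lt_le_trans sa) //= (le_lt_trans ut).
have [u||u _ ->] := @MVT_segment R f (fun=> 0) s t st.
- by rewrite in_itv /= => /andP[/ltW su /ltW ut]; apply/df/inI; rewrite su.
- by apply: derivable_within_continuous => u; rewrite in_itv /= => /inI /df[].
- by rewrite mul0r.
Qed.

Lemma near_itv (a b t : R) : a < t < b -> \forall s \near t, a < s < b.
Proof.
move=> tI; near=> s.
have : s \in `]a, b[ by near: s; apply: near_in_itvoo; rewrite in_itv.
by rewrite in_itv.
Unshelve. all: by end_near. Qed.

(** If w = u' satisfies w' = l w, then the functions w_i w_j / |w|^2 have zero
    derivative: the direction of w is constant up to sign.  Using these rank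
    one projections instead of w / |w| avoids square roots. *)
Lemma straight_of_parallel_acceleration (t0 t1 : R) (u : R -> V) (l : R -> R) :
  (forall t : R, t0 < t < t1 ->
    [/\ derivable u t 1, derivable (derive1 u) t 1, derive1 u t != 0 &
      derive1 (derive1 u) t = l t *: derive1 u t]) ->
  on_straight_line t0 t1 u.
Proof.
move=> uP.
have [[s sI]|nI] := pselect (exists s : R, t0 < s < t1); last first.
  by exists 0, 0 => t tI; case: nI; exists t.
have [w wu'] : {w : R -> V | w = derive1 u} by exists (derive1 u).
pose N t := \sum_i w t 0 i ^+ 2.
rewrite -wu' in uP.
have du (t : R) i : t0 < t < t1 -> is_derive t 1 (fun t => u t 0 i) (w t 0 i).
  move=> /uP[dut _ _ _]; apply: is_derive_entry.
  by split; [exact: dut | rewrite wu' derive1E].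
have dw (t : R) i : t0 < t < t1 -> is_derive t 1 (fun t => w t 0 i) (l t * w t 0 i).
  move=> /uP[_ dwt _ wE]; have -> : l t * w t 0 i = (l t *: w t) 0 i by rewrite mxE.
  by apply: is_derive_entry; split; [exact: dwt | rewrite -wE derive1E].
have N0 (t : R) : t0 < t < t1 -> N t != 0.
  move=> /uP[_ _ wt _]; apply: contraNneq wt => Nt.
  have := psumr_eq0P (fun i _ => sqr_ge0 (w t 0 i)) Nt.
  by move=> w0; apply/eqP/rowP => i; rewrite mxE; apply/eqP; rewrite -sqrf_eq0 w0.
have dN (t : R) : t0 < t < t1 -> is_derive t 1 N (2 * l t * N t).
  move=> tI.
  have := @is_derive_sum R R R n (fun i t => w t 0 i ^+ 2) t 1 (fun i => 2 * l t * w t 0 i ^+ 2).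
  have -> : \sum_(i < n) (fun t => w t 0 i ^+ 2) = N.
    by apply/funext => r; rewrite /N fct_sumE.
  rewrite -mulr_sumr; apply => i.
  have dwi := dw t i tI.
  have dM := @is_deriveM R R _ _ t 1 _ _ dwi dwi.
  apply: (is_derive_congr dM) => [r|]; first by rewrite expr2.
  by rewrite /GRing.scale /=; ring.
have w_dir i j (t : R) : t0 < t < t1 ->
    w t 0 i * w t 0 j / N t = w s 0 i * w s 0 j / N s.
  move=> tI; apply: (@constant_of_zero_derivative (fun t => w t 0 i * w t 0 j / N t) t0 t1 _ t s tI sI) => r rI.
  have dwi := dw r i rI; have dwj := dw r j rI; have dNr := dN r rI.
  have Nr := N0 r rI.
  apply: (is_derive_congr (is_derive_mul (is_derive_mul dwi dwj) (is_derive_inv Nr dNr))) => //.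
  by field.
have [e eE] : {e : V | e = w s} by exists (w s).
(* c t is the coordinate along e of the displacement u t - u s. *)
pose c t := (\sum_i (u t 0 i - u s 0 i) * e 0 i) / N s.
exists (u s), e => t tI; exists (c t).
have dc (r : R) : t0 < r < t1 ->
    is_derive r 1 c ((\sum_i w r 0 i * e 0 i) / N s).
  move=> rI.
  have := @is_derive_sum R R R n (fun i t => (u t 0 i - u s 0 i) * (e 0 i / N s)) r 1
    (fun i => w r 0 i * (e 0 i / N s)).
  have -> : \sum_(i < n) (fun t => (u t 0 i - u s 0 i) * (e 0 i / N s)) = c.
    by apply/funext => q; rewrite /c fct_sumE mulr_suml; apply: eq_bigr => i _; rewrite mulrA.
  rewrite mulr_suml; under eq_bigr do rewrite mulrA; apply => i.
  have dui := du r i rI.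
  have dB := @is_deriveB R R R (fun t => u t 0 i) (cst (u s 0 i)) r 1 _ _ dui (is_derive_cst _ _ _).
  have dM := @is_deriveM R R _ (cst (e 0 i / N s)) r 1 _ _ dB (is_derive_cst _ _ _).
  apply: (is_derive_congr dM) => //.
  by rewrite scaler0 add0r subr0 /cst /GRing.scale /= mulrC.
have wE (r : R) i : t0 < r < t1 -> w r 0 i = (\sum_j w r 0 j * e 0 j) / N s * e 0 i.
  move=> rI; apply: (mulIf (N0 r rI)).
  rewrite [LHS]mulrC {1}/N mulr_suml !mulr_suml; apply: eq_bigr => j _.
  have := w_dir j i r rI; rewrite -eE => wji.
  have -> : w r 0 j * e 0 j / N s * e 0 i * N r = w r 0 j * (e 0 j * e 0 i / N s) * N r by ring.
  by rewrite -wji -mulrA divfK ?N0 // expr2 mulrA.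
apply/rowP => i; rewrite !mxE.
have : u t 0 i - c t * e 0 i = u s 0 i - c s * e 0 i.
  apply: (@constant_of_zero_derivative (fun t => u t 0 i - c t * e 0 i) t0 t1 _ t s tI sI) => r rI.
  have dui := du r i rI; have dcr := dc r rI.
  have dM := @is_deriveM R R c (cst (e 0 i)) r 1 _ _ dcr (is_derive_cst _ _ _).
  have dB := @is_deriveB R R R _ _ r 1 _ _ dui dM.
  apply: (is_derive_congr dB) => //.
  by rewrite scaler0 add0r /cst /GRing.scale /= mulrC -wE // subrr.
rewrite {2}/c big1 => [|j _]; last by rewrite subrr mul0r.
by rewrite !mul0r subr0 => /eqP; rewrite subr_eq => /eqP.
Qed.

(** On a straight line directed by v, the minors of (u - p, v) vanish; deriving
    them once and twice, so do those of (u', v) and (u'', v).  The case v = 0 is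
    excluded because u would be constant. *)
Lemma parallel_acceleration_of_straight (h : R) (u : R -> V) : 0 < h ->
  (forall t : R, - h < t < h -> derivable u t 1) -> derivable (derive1 u) 0 1 ->
  derive1 u 0 != 0 -> on_straight_line (- h) h u ->
  exists c : R, derive1 (derive1 u) 0 = c *: derive1 u 0.
Proof.
move=> h0 du ddu u'0 [p [v uv]].
pose m (z : V) i j := z 0 i * v 0 j - z 0 j * v 0 i.
have dm (f : R -> V) (t : R) i j : derivable f t 1 ->
    is_derive t 1 (fun s => m (f s) i j) (m (derive1 f t) i j).
  move=> df; have fE : is_derive t 1 f (derive1 f t) by split; [exact: df | rewrite derive1E].
  have dM k l := @is_deriveM R R _ (cst (v 0 l)) t 1 _ _ (is_derive_entry k fE) (is_derive_cst _ _ _).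
  have dB := @is_deriveB R R R _ _ t 1 _ _ (dM i j) (dM j i).
  apply: (is_derive_congr dB) => //.
  by rewrite !scaler0 !add0r /cst /GRing.scale /m /= [v 0 j * _]mulrC [v 0 i * _]mulrC.
have mu' i j (t : R) : - h < t < h -> m (derive1 u t) i j = 0.
  move=> tI; have [_ <-] := dm u t i j (du t tI).
  rewrite (@near_eq_derive _ _ _ _ (cst (m p i j))) ?derive_cst //.
  near=> s.
  have /uv[c ->] : - h < s < h by near: s; exact: near_itv.
  by rewrite /cst /m !mxE; ring.
have I0 : - h < 0 < h by rewrite ltrNl oppr0 h0.
have mu'' i j : m (derive1 (derive1 u) 0) i j = 0.
  have [_ <-] := dm (derive1 u) 0 i j ddu.
  rewrite (@near_eq_derive _ _ _ _ (cst 0)) ?derive_cst //.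
  by near=> s; apply: mu'; near: s; exact: near_itv.
have [v0|v0] := eqVneq v 0.
  case/eqP: u'0; rewrite derive1E (@near_eq_derive _ _ _ _ (cst p)) ?derive_cst //.
  near=> s.
  have /uv[c ->] : - h < s < h by near: s; exact: near_itv.
  by rewrite v0 scaler0 addr0.
have /rV0Pn[k vk] := v0.
have par z : (forall i j, m z i j = 0) -> z = (z 0 k / v 0 k) *: v.
  move=> mz; apply/rowP => i; rewrite mxE; apply: (mulIf vk).
  by rewrite mulrAC divfK //; apply/eqP; rewrite -subr_eq0; apply/eqP; exact: mz.
have y_par := par _ (fun i j => mu' i j 0 I0); have a_par := par _ mu''.
have yk : derive1 u 0 0 k != 0.
  by apply: contraNneq u'0 => yk; rewrite y_par yk mul0r scale0r.
exists (derive1 (derive1 u) 0 0 k / derive1 u 0 0 k).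
rewrite [LHS]a_par [X in _ = _ *: X]y_par scalerA; congr (_ *: _).
by rewrite mulrA divfK.
Unshelve. all: by end_near. Qed.

End StraightLines.

(** * Euler's relations and the spray *)

Section Hamel.
Context (R : realType) (n : nat).
Local Notation V := 'rV[R]_n.
Implicit Types (x y v : V).

Lemma smooth_snd_entry (W : set (V * V)) i : smooth_on W (fun z : V * V => z.2 0 i : R^o).
Proof.
apply: smooth_linear.
  move=> z; apply: (@continuous_comp _ _ _ snd (fun y : V => y 0 i)); first exact: cvg_snd.
  exact: coord_continuous.
by move=> z w; apply: is_derive_linear => [u w'|c w']; rewrite !mxE.
Qed.

Lemma smooth_on_det m (W : set (V * V)) (A : V * V -> 'M[R]_m) : open W ->
  (forall i j, smooth_on W (fun z => A z i j : R^o)) ->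
  smooth_on W (fun z => \det (A z) : R^o).
Proof.
move=> oW sA; apply: smooth_on_sum => // s; apply: smooth_onZ => //.
exact: smooth_on_prod.
Qed.

Lemma smooth_on_invmx m (W : set (V * V)) (A : V * V -> 'M[R]_m) : open W ->
  (forall i j, smooth_on W (fun z => A z i j : R^o)) ->
  (forall z, W z -> A z \in unitmx) ->
  forall i j, smooth_on W (fun z => invmx (A z) i j : R^o).
Proof.
move=> oW sA uA i j.
have sdet := smooth_on_det oW sA.
have det0 z : W z -> \det (A z) != 0 by move=> /uA; rewrite unitmxE unitfE.
have sadj : smooth_on W (fun z => \adj (A z) i j : R^o).
  have sminor : smooth_on W (fun z => \det (row' j (col' i (A z))) : R^o).
    apply: (smooth_on_det (A := fun z => row' j (col' i (A z))) oW) => k l.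
    by apply: (smooth_on_eq oW (sA (lift j k) (lift i l))) => z _; rewrite [RHS]mxE [RHS]mxE.
  apply: (smooth_on_eq oW (smooth_onZ oW ((-1) ^+ (j + i)) sminor)) => z _.
  by rewrite [RHS]mxE.
apply: (smooth_on_eq oW (smooth_onM oW (smooth_onV oW sdet det0) sadj)) => z Wz.
by rewrite /invmx uA // [RHS]mxE.
Qed.

(** Coordinate domain of the slit tangent bundle over U. *)
Definition slit (U : set V) : set (V * V) := [set z | U z.1 /\ z.2 != 0].

Definition uncurried (f : V -> V -> R) : V * V -> R^o := fun z => f z.1 z.2.

Definition hamel (U : set V) (f : V -> V -> R) : Prop :=
  forall x y v, U x -> y != 0 ->
    'D_((y, 0) : V * V) ('D_((0, v) : V * V) (uncurried f)) (x, y) =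
    'D_((v, 0) : V * V) (uncurried f) (x, y).

(** Strong convexity enters through the invertibility of the fundamental tensor,
    which makes the spray the solution of a linear equation. *)
Definition regular_metric (U : set V) (f : V -> V -> R) : Prop :=
  [/\ smooth_on (slit U) (uncurried f),
    forall x y, U x -> y != 0 -> 0 < f x y,
    forall x y l, U x -> 0 < l -> f x (l *: y) = l * f x y &
    forall x y, U x -> y != 0 -> fundamental_tensor f x y \in unitmx].

Lemma pair0D (u w : V) : ((0, u + w) : V * V) = (0, u) + (0, w).
Proof. by rewrite /GRing.add /= /add_pair /= addr0. Qed.
Lemma pairD0 (u w : V) : ((u + w, 0) : V * V) = (u, 0) + (w, 0).
Proof. by rewrite [in RHS]/GRing.add /= /add_pair /= addr0. Qed.
Lemma pair0Z (c : R) (w : V) : ((0, c *: w) : V * V) = c *: ((0, w) : V * V).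
Proof. by rewrite [in RHS]/GRing.scale /= /scale_pair /= scaler0. Qed.
Lemma pairZ0 (c : R) (w : V) : ((c *: w, 0) : V * V) = c *: ((w, 0) : V * V).
Proof. by rewrite [in RHS]/GRing.scale /= /scale_pair /= scaler0. Qed.

Lemma pair0_sum (w : V) : ((0, w) : V * V) = \sum_i w 0 i *: ((0, delta_mx 0 i) : V * V).
Proof.
rewrite {1}[w]row_sum_delta; elim/big_ind2 : _ => // [_ u _ u' <- <-|i _].
  exact: pair0D.
exact: pair0Z.
Qed.

Lemma pair_sum0 (w : V) : ((w, 0) : V * V) = \sum_i w 0 i *: ((delta_mx 0 i, 0) : V * V).
Proof.
rewrite {1}[w]row_sum_delta; elim/big_ind2 : _ => // [_ u _ u' <- <-|i _].
  exact: pairD0.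
exact: pairZ0.
Qed.

Section DirectionExpansion.
Context (W : set (V * V)) (oW : open W) (g : V * V -> R^o).
Hypothesis sg : smooth_on W g.

Lemma derive_fiber_expand z w : W z ->
  'D_((0, w) : V * V) g z = \sum_i w 0 i * 'D_((0, delta_mx 0 i) : V * V) g z.
Proof.
move=> Wz; rewrite pair0_sum (derive_dir_sum oW) //.
by apply: eq_bigr => i _; rewrite (derive_dirZS _ _ sg).
Qed.

Lemma derive_base_expand z w : W z ->
  'D_((w, 0) : V * V) g z = \sum_i w 0 i * 'D_((delta_mx 0 i, 0) : V * V) g z.
Proof.
move=> Wz; rewrite pair_sum0 (derive_dir_sum oW) //.
by apply: eq_bigr => i _; rewrite (derive_dirZS _ _ sg).
Qed.

End DirectionExpansion.

Section Metric.
Context (U : set V) (f : V -> V -> R).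
Hypotheses (oU : open U) (sf : smooth_on (slit U) (uncurried f)).
Hypothesis fhomog : forall x y l, U x -> 0 < l -> f x (l *: y) = l * f x y.
Local Notation fu := (uncurried f).
Local Notation Dy v g := ('D_((0, v) : V * V) g).
Local Notation Dx v g := ('D_((v, 0) : V * V) g).

Let oW : open (slit U). Proof. exact: open_slit_tangent. Qed.

Definition energy : V * V -> R^o := fun z => f z.1 z.2 ^+ 2.

Lemma smooth_energy : smooth_on (slit U) energy.
Proof. exact: (smooth_onX oW 2 sf). Qed.

(** Along y, a homogeneous function is affine. *)
Lemma euler x y : U x -> y != 0 -> Dy y fu (x, y) = f x y.
Proof.
move=> Ux y0.
suff : is_derive (x, y) ((0, y) : V * V) fu (f x y) by case.
apply/is_derive_cvg; apply: cvg_near_cst; near=> h.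
have h1 : 0 < 1 + h.
  have : `|h| < 1 by near: h; exact: dnbhs0_lt.
  by rewrite ltr_norml => /andP[]; lra.
have h0 : h != 0 by near: h; exact: nbhs_dnbhs_neq.
rewrite /uncurried /= scaler0 add0r -[X in h *: y + X]scale1r -scalerDl addrC.
rewrite addrC [h + 1]addrC fhomog // mulrDl mul1r addrAC subrr add0r.
by rewrite [_ *: _]mulKf.
Unshelve. all: by end_near. Qed.

Lemma fiber_derivative_homog x y v l : U x -> y != 0 -> 0 < l ->
  Dy v fu (x, l *: y) = Dy v fu (x, y).
Proof.
move=> Ux y0 l0.
have ln0 : l != 0 by rewrite gt_eqF.
have Wl : slit U (x, l *: y) by split => //=; rewrite scaler_eq0 negb_or ln0.
have W1 : slit U (x, y) by [].
apply: (mulfI ln0).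
rewrite -(derive_dirZS _ _ sf) // -pair0Z.
suff : is_derive (x, l *: y) ((0, l *: v) : V * V) fu (l * Dy v fu (x, y)) by case.
have /derivableP /is_derive_cvg dv := smooth_derivable (v := ((0, v) : V * V)) sf W1.
apply/is_derive_cvg.
rewrite (_ : (fun h => _) = (fun h : R => l *: (h^-1 *: (fu (h *: ((0, v) : V * V) + (x, y)) - fu (x, y))))).
  exact: cvgZr.
apply/funext => h; rewrite /uncurried /= scaler0 add0r scalerA mulrC -scalerA.
by rewrite -scalerDr !fhomog // -mulrBr [LHS]mulrCA.
Qed.

Lemma euler_fiber_derivative x y v : U x -> y != 0 -> Dy y (Dy v fu) (x, y) = 0.
Proof.
move=> Ux y0.
suff : is_derive (x, y) ((0, y) : V * V) (Dy v fu) 0 by case.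
apply/is_derive_cvg; apply: cvg_near_cst; near=> h.
have h1 : 0 < 1 + h.
  have : `|h| < 1 by near: h; exact: dnbhs0_lt.
  by rewrite ltr_norml => /andP[]; lra.
have -> : h *: ((0, y) : V * V) + (x, y) = (x, (1 + h) *: y).
  by rewrite -pair0Z /GRing.add /= /add_pair /= add0r scalerDl scale1r addrC.
by rewrite fiber_derivative_homog // subrr scaler0.
Unshelve. all: by end_near. Qed.

Lemma derive_energy x y w : slit U (x, y) -> 'D_w energy (x, y) = 2 * f x y * 'D_w fu (x, y).
Proof.
move=> Wz.
have dw := derivableP (smooth_derivable (v := w) sf Wz).
have dE : is_derive (x, y) w energy (2 * f x y * 'D_w fu (x, y)).
  apply: (is_derive_congr (is_derive_mul dw dw)) => [z|]; first by rewrite /energy expr2.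
  by move: ('D_w fu (x, y)) => d; rewrite /uncurried /=; ring.
by case: dE.
Qed.

Lemma derive2_energy x y w w' : slit U (x, y) ->
  'D_w ('D_w' energy) (x, y) =
  2 * ('D_w fu (x, y) * 'D_w' fu (x, y) + f x y * 'D_w ('D_w' fu) (x, y)).
Proof.
move=> Wz.
pose g (z : V * V) : R := 2 * (fu z : R) * ('D_w' fu z : R).
have dE : 'D_w ('D_w' energy) (x, y) = 'D_w (g : V * V -> R^o) (x, y).
  apply: (@eq_derive_open _ _ _ oW ('D_w' energy) g (x, y) w _ Wz).
  by move=> [x' y'] Wz'; exact: derive_energy.
rewrite dE.
have dw := derivableP (smooth_derivable (v := w) sf Wz).
have dww := derivableP (smooth_derivable (v := w) (smooth_derive w' sf) Wz).
have [_ ->] := is_derive_mul (is_derive_mul (is_derive_cst (2 : R^o) (x, y) w) dw) dww.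
move: ('D_w fu _) ('D_w' fu _) ('D_w ('D_w' fu) _) => d d' dd.
by rewrite /uncurried /=; ring.
Qed.

Lemma fundamental_tensorE x y i j :
  fundamental_tensor f x y i j = 2^-1 * Dy (delta_mx 0 i) (Dy (delta_mx 0 j) energy) (x, y).
Proof.
rewrite [LHS]mxE; apply: (congr1 (fun d => 2^-1 * d)).
transitivity ('D_(delta_mx 0 i) (fun z => Dy (delta_mx 0 j) energy (x, z)) y).
  apply: (congr1 (fun g => 'D_(delta_mx 0 i) g y)); apply/funext => z.
  exact: (derive_snd energy).
exact: (derive_snd (Dy (delta_mx 0 j) energy)).
Qed.

Lemma mulmx_fundamental_tensor x y w j : U x -> y != 0 ->
  (w *m fundamental_tensor f x y) 0 j =
  Dy w fu (x, y) * Dy (delta_mx 0 j) fu (x, y) +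
  f x y * Dy w (Dy (delta_mx 0 j) fu) (x, y).
Proof.
move=> Ux y0; have Wz : slit U (x, y) by [].
apply: (mulfI (_ : 2 != 0)); first by rewrite pnatr_eq0.
have dE := @derive2_energy x y (0, w) (0, delta_mx 0 j) Wz.
have dL := derive_fiber_expand oW (smooth_derive (0, delta_mx 0 j) smooth_energy) w Wz.
apply: etrans dE; apply: etrans (esym dL).
rewrite [X in 2 * X]mxE mulr_sumr; apply: eq_bigr => i _; rewrite fundamental_tensorE.
by move: (derive _ _ _) => d; field.
Qed.

(** Four times the spray, lowered by the fundamental tensor. *)
Definition spray_covector x y : V :=
  \row_l (Dx y (Dy (delta_mx 0 l) energy) (x, y) - Dx (delta_mx 0 l) energy (x, y)).

Lemma spray_coefficientsE x y : U x -> y != 0 ->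
  spray_coefficients f x y =
  4^-1 *: (spray_covector x y *m invmx (fundamental_tensor f x y)).
Proof.
move=> Ux y0; have Wz : slit U (x, y) by [].
apply: (congr1 (fun c => 4^-1 *: (c *m invmx (fundamental_tensor f x y)))).
apply/rowP => l; rewrite [LHS]mxE [RHS]mxE.
have dL := derive_base_expand oW (smooth_derive (0, delta_mx 0 l) smooth_energy) y Wz.
apply: (congr2 (fun a b => a - b)); last exact: (derive_fst energy).
rewrite dL; apply: eq_bigr => k _; rewrite mulrC.
apply: (congr1 (fun d => y 0 k * d)).
transitivity ('D_(delta_mx 0 k) (fun z => Dy (delta_mx 0 l) energy (z, y)) x).
  apply: (congr1 (fun g => 'D_(delta_mx 0 k) g x)); apply/funext => z.
  exact: (derive_snd energy).
exact: (derive_fst (Dy (delta_mx 0 l) energy)).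
Qed.

(** The last term contains the defect of Hamel's relation, the first one is the
    part of the spray that is parallel to y. *)
Lemma spray_covectorE x y l : U x -> y != 0 ->
  spray_covector x y 0 l =
  2 * Dx y fu (x, y) * Dy (delta_mx 0 l) fu (x, y) +
  2 * f x y * (Dx y (Dy (delta_mx 0 l) fu) (x, y) - Dx (delta_mx 0 l) fu (x, y)).
Proof.
move=> Ux y0; have Wz : slit U (x, y) by [].
rewrite mxE derive2_energy // derive_energy //.
move: (Dx y fu _) (Dy _ fu _) (Dx _ (Dy _ fu) _) (Dx (delta_mx 0 l) fu _) => a b c d; ring.
Qed.

End Metric.

End Hamel.

(** * Straight geodesics and Hamel's relation *)

Section StraightGeodesics.
Context (R : realType) (n : nat).
Local Notation V := 'rV[R]_n.
Context (U : set V) (f : V -> V -> R).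
Hypotheses (oU : open U) (rf : regular_metric U f).
Local Notation fu := (uncurried f).
Local Notation Dy v g := ('D_((0, v) : V * V) g).
Local Notation Dx v g := ('D_((v, 0) : V * V) g).
Implicit Types (x y v : V).

Let oW : open (slit U). Proof. exact: open_slit_tangent. Qed.
Let sf : smooth_on (slit U) fu. Proof. by case: rf. Qed.
Let fpos x y : U x -> y != 0 -> 0 < f x y.
Proof. by case: rf => _ + _ _; exact. Qed.
Let fhomog x y l : U x -> 0 < l -> f x (l *: y) = l * f x y.
Proof. by case: rf => _ _ + _; exact. Qed.
Let funit x y : U x -> y != 0 -> fundamental_tensor f x y \in unitmx.
Proof. by case: rf => _ _ _; exact. Qed.

(** Linear in f, unlike the spray; it measures the non-closedness of f when f is a
    1-form, and the deviation of the geodesics from lines when f is a metric. *)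
Definition hamel_defect x y v : R := Dx y (Dy v fu) (x, y) - Dx v fu (x, y).

Lemma hamel_defect_expand x y v : U x -> y != 0 ->
  hamel_defect x y v = \sum_l v 0 l * hamel_defect x y (delta_mx 0 l).
Proof.
move=> Ux y0; have Wz : slit U (x, y) by [].
under eq_bigr do rewrite mulrBr; rewrite sumrB.
have dL := derive_base_expand oW sf v Wz.
apply: (congr2 (fun a b => a - b)); last exact: dL.
have dE : Dx y (Dy v fu) (x, y) =
    Dx y (\sum_l (fun z => v 0 l * Dy (delta_mx 0 l) fu z : R^o)) (x, y).
  apply: (@eq_derive_open _ _ _ oW _ _ (x, y) (y, 0) _ Wz) => z Wz'.
  by rewrite fct_sumE; exact: (derive_fiber_expand oW sf v Wz').
rewrite dE derive_sum => [|l].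
  apply: eq_bigr => l _.
  have sl := smooth_derive (0, delta_mx 0 l) sf.
  exact: (deriveZ (v 0 l) (smooth_derivable sl Wz)).
have sl := smooth_onZ oW (v 0 l) (smooth_derive (0, delta_mx 0 l) sf).
exact: (smooth_derivable sl Wz).
Qed.

(** Since y is a constant vector here, D_y[y] f can be replaced by f along the
    points (x', y) before deriving in x. *)
Lemma hamel_defect_self x y : U x -> y != 0 -> hamel_defect x y y = 0.
Proof.
move=> Ux y0; apply/eqP; rewrite subr_eq0; apply/eqP.
apply: etrans (esym (derive_fst (Dy y fu) x y y)) _.
apply: etrans (derive_fst fu x y y).
apply: (@eq_derive_open _ _ _ oU (fun z => Dy y fu (z, y)) (fun z => fu (z, y)) x y _ Ux) => z Uz.
exact: (euler fhomog Uz y0).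
Qed.

Lemma spray_covector_hamel x y l : U x -> y != 0 ->
  spray_covector f x y 0 l =
  2 * Dx y fu (x, y) * Dy (delta_mx 0 l) fu (x, y) +
  2 * f x y * hamel_defect x y (delta_mx 0 l).
Proof. by move=> Ux y0; exact: (spray_covectorE oU sf). Qed.

(** The second derivative contributes nothing because D_y[v] f has degree 0. *)
Lemma mulmx_fundamental_tensor_self x y l : U x -> y != 0 ->
  (y *m fundamental_tensor f x y) 0 l = f x y * Dy (delta_mx 0 l) fu (x, y).
Proof.
move=> Ux y0; rewrite (mulmx_fundamental_tensor oU sf) // (euler fhomog) //.
by rewrite (euler_fiber_derivative sf fhomog) // mulr0 addr0.
Qed.

Lemma spray_of_hamel x y : U x -> y != 0 ->
  (forall v, hamel_defect x y v = 0) ->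
  spray_coefficients f x y = (Dx y fu (x, y) / (2 * f x y)) *: y.
Proof.
move=> Ux y0 hd; have f0 : f x y != 0 by rewrite gt_eqF ?fpos.
rewrite (spray_coefficientsE oU sf) //.
suff -> : spray_covector f x y =
    (4 * (Dx y fu (x, y) / (2 * f x y))) *: (y *m fundamental_tensor f x y).
  by rewrite -scalemxAl mulmxK ?funit // scalerA mulKf // pnatr_eq0.
apply/rowP => l; rewrite spray_covector_hamel // hd.
rewrite [RHS]mxE mulmx_fundamental_tensor_self //.
by move: (Dx y fu _) (Dy _ fu _) => a b; field.
Qed.

(** Contracting the lowered equation with y determines c by Euler's relation,
    because the defect vanishes on y; what remains of the equation is the
    vanishing of f times the defect. *)
Lemma hamel_of_spray x y c : U x -> y != 0 ->
  spray_coefficients f x y = c *: y -> forall v, hamel_defect x y v = 0.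
Proof.
move=> Ux y0; have f0 : f x y != 0 by rewrite gt_eqF ?fpos.
have Wz : slit U (x, y) by [].
rewrite (spray_coefficientsE oU sf) // => sE.
have covE l : spray_covector f x y 0 l = 4 * c * f x y * Dy (delta_mx 0 l) fu (x, y).
  have : spray_covector f x y = (4 * c) *: (y *m fundamental_tensor f x y).
    rewrite -scalerA scalemxAl -sE -scalemxAl scalerA divff ?pnatr_eq0 // scale1r.
    by rewrite mulmxKV ?funit.
  by move=> ->; rewrite mxE mulmx_fundamental_tensor_self // !mulrA.
have eqn l : 2 * Dx y fu (x, y) * Dy (delta_mx 0 l) fu (x, y) +
    2 * f x y * hamel_defect x y (delta_mx 0 l) =
    4 * c * f x y * Dy (delta_mx 0 l) fu (x, y).
  by rewrite -spray_covector_hamel.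
have eul : \sum_l y 0 l * Dy (delta_mx 0 l) fu (x, y) = f x y.
  by rewrite -(derive_fiber_expand oW sf y Wz) (euler fhomog).
have cE : 2 * Dx y fu (x, y) = 4 * c * f x y.
  pose H l := hamel_defect x y (delta_mx 0 l); pose D l : R := Dy (delta_mx 0 l) fu (x, y).
  have h0 : \sum_l y 0 l * H l = 0 by rewrite -hamel_defect_expand // hamel_defect_self.
  have e0 : \sum_l y 0 l * D l = f x y by exact: eul.
  apply: (mulIf f0).
  transitivity (\sum_l y 0 l * (2 * Dx y fu (x, y) * D l + 2 * f x y * H l)).
    under eq_bigr do rewrite mulrDr mulrCA [X in _ + X]mulrCA.
    by rewrite big_split /= -!mulr_sumr h0 e0 mulr0 addr0.
  under eq_bigr do rewrite eqn mulrCA.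
  by rewrite -mulr_sumr e0.
have hl l : hamel_defect x y (delta_mx 0 l) = 0.
  have := eqn l; rewrite cE => /(canRL (addKr _)); rewrite addNr => /eqP.
  by rewrite !mulf_eq0 pnatr_eq0 (negbTE f0) /= => /eqP.
by move=> v; rewrite hamel_defect_expand // big1 // => l _; rewrite hl mulr0.
Qed.

Lemma smooth_spray i :
  smooth_on (slit U) (fun z => spray_coefficients f z.1 z.2 0 i : R^o).
Proof.
have sL := smooth_energy oU sf.
have scov l : smooth_on (slit U) (fun z => spray_covector f z.1 z.2 0 l : R^o).
  pose g (z : V * V) : R^o := \sum_k (z.2 0 k * Dx (delta_mx 0 k) (Dy (delta_mx 0 l) (energy f)) z : R).
  have sg : smooth_on (slit U) g.
    apply: (smooth_on_sum oW) => k; apply: (smooth_onM oW); first exact: smooth_snd_entry.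
    exact: smooth_derive (smooth_derive _ sL).
  apply: (smooth_on_eq oW (smooth_onD oW sg (smooth_onN oW (smooth_derive (delta_mx 0 l, 0) sL)))).
  move=> [x y] Wz; rewrite [RHS]mxE; apply: (congr2 (fun a b => a - b)) => //.
  by rewrite (derive_base_expand oW (smooth_derive (0, delta_mx 0 l) sL) y Wz).
have sten k l : smooth_on (slit U) (fun z => fundamental_tensor f z.1 z.2 k l : R^o).
  apply: (smooth_on_eq oW (smooth_onZ oW 2^-1
    (smooth_derive (0, delta_mx 0 k) (smooth_derive (0, delta_mx 0 l) sL)))) => -[x y] _.
  by rewrite fundamental_tensorE.
have sinv := smooth_on_invmx oW sten (fun z Wz => funit Wz.1 Wz.2).
have sM k := smooth_onM oW (scov k) (sinv k i).
apply: (smooth_on_eq oW (smooth_onZ oW 4^-1 (smooth_on_sum oW (index_enum _) predT sM))).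
move=> [x y] [Ux y0]; rewrite (spray_coefficientsE oU sf) // [RHS]mxE.
by apply: (congr1 (fun d => 4^-1 * d)); rewrite mxE.
Qed.

Theorem straight_geodesics_iff_hamel :
  (forall t0 t1 u, geodesic f U t0 t1 u -> on_straight_line t0 t1 u) <-> hamel U f.
Proof.
split=> [straight x y v Ux y0|hf t0 t1 u gu].
- apply/eqP; rewrite -subr_eq0; apply/eqP.
  have sG i : smooth_on (slit U) (fun z => (-2 *: spray_coefficients f z.1 z.2) 0 i : R^o).
    by apply: (smooth_on_eq oW (smooth_onZ oW (-2) (smooth_spray i))) => z _; rewrite [RHS]mxE.
  have [h [u [h0 u0 u'0 uP]]] := second_order_solution oU Ux y0 sG.
  have I0 : - h < 0 < h by rewrite ltrNl oppr0 h0.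
  have gu : geodesic f U (- h) h u.
    move=> t tI; have [Ut dut ddut u't u''] := uP t tI.
    by split; [exact: Ut | exact: dut | exact: ddut | exact: u't |
               rewrite u'' -scalerDl addNr scale0r].
  have [_ _ ddu u'n0 u''E] := uP 0 I0.
  have du t : - h < t < h -> derivable u t 1 by move=> /uP[].
  have [c cE] := parallel_acceleration_of_straight h0 du ddu u'n0 (straight _ _ _ gu).
  apply: (@hamel_of_spray x y (- c / 2)) => //.
  rewrite u''E u0 u'0 /= in cE.
  have -> : spray_coefficients f x y = (- 2^-1) *: (-2 *: spray_coefficients f x y).
    by rewrite scalerA mulrNN mulVf ?scale1r // pnatr_eq0.
  by rewrite cE scalerA mulNr mulrC mulNr.
- pose l t := - (Dx (derive1 u t) fu (u t, derive1 u t) / f (u t) (derive1 u t)).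
  apply: (@straight_of_parallel_acceleration _ _ _ _ _ l) => t tI.
  have [Ut dut ddut u't uE] := gu t tI.
  split; [exact: dut | exact: ddut | exact: u't |].
  have hd v : hamel_defect (u t) (derive1 u t) v = 0.
    by rewrite /hamel_defect hf // subrr.
  have f0 : f (u t) (derive1 u t) != 0 by rewrite gt_eqF ?fpos.
  move: uE; rewrite spray_of_hamel // => /eqP; rewrite addr_eq0 => /eqP ->.
  rewrite scalerA -scaleNr /l; congr (_ *: _).
  by move: (derive _ _ _) => d; field.
Qed.

End StraightGeodesics.

(** * Linearity of Hamel's relation and reflection of the fibers *)

Section FiberReflection.
Context (R : realType) (n : nat).
Local Notation V := 'rV[R]_n.
Implicit Types (z : V * V) (k : V * V -> R^o).

Definition reflect_fiber z : V * V := (z.1, - z.2).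

(** Difference quotients are equal term by term, so derivability and derivative
    of k and of its reflection correspond. *)
Lemma reflect_quotient k z v :
  (fun h : R => h^-1 *: (k (reflect_fiber (h *: v + z)) - k (reflect_fiber z))) =
  (fun h : R => h^-1 *: (k (h *: reflect_fiber v + reflect_fiber z) - k (reflect_fiber z))).
Proof.
apply/funext => h; apply: (congr1 (fun d => h^-1 *: (k d - _))).
by rewrite /reflect_fiber /GRing.add /GRing.scale /= /add_pair /scale_pair /= opprD scalerN.
Qed.

Lemma derive_reflect k z v :
  'D_v (k \o reflect_fiber) z = 'D_(reflect_fiber v) k (reflect_fiber z).
Proof. by rewrite /derive -reflect_quotient. Qed.

Lemma derivable_reflect k z v : derivable k (reflect_fiber z) (reflect_fiber v) ->
  derivable (k \o reflect_fiber) z v.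
Proof. by rewrite /derivable -reflect_quotient. Qed.

Lemma reflect_slit (U : set V) z : slit U z -> slit U (reflect_fiber z).
Proof. by move=> [? ?]; split=> //=; rewrite oppr_eq0. Qed.

Lemma continuous_reflect : continuous reflect_fiber.
Proof.
apply: (lipschitz_continuous ler01) => z z'; rewrite mul1r.
have -> : reflect_fiber z - reflect_fiber z' = reflect_fiber (z - z').
  by apply: injective_projections; [| exact: (esym (opprD z.2 (- z'.2)))].
case: (z - z') => a b; change (Num.max `|a| `|- b| <= Num.max `|a| `|b|).
by rewrite normrN.
Qed.

Lemma smooth_reflect (U : set V) k : open U -> smooth_on (slit U) k ->
  smooth_on (slit U) (k \o reflect_fiber).
Proof.
move=> oU sk; have oW := open_slit_tangent oU.
apply: (@smooth_coind R _ (slit U) (fun h => exists2 k : V * V -> R^o, smooth_on (slit U) k &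
    h = k \o reflect_fiber)); last by exists k.
- move=> _ z [l sl ->] /reflect_slit Wz; split=> [|v].
    apply: (@continuous_comp _ _ _ reflect_fiber l z); last exact: (smooth_continuous sl Wz).
    exact: continuous_reflect.
  exact: derivable_reflect (smooth_derivable sl Wz).
- move=> _ v [l sl ->]; exists ('D_(reflect_fiber v) l); first exact: smooth_derive.
  by apply/funext => z; exact: derive_reflect.
Qed.

End FiberReflection.
Arguments reflect_fiber {R n} z.

Section HamelDefect.
Context (R : realType) (n : nat).
Local Notation V := 'rV[R]_n.
Context (U : set V) (oU : open U).
Implicit Types (f g : V -> V -> R) (x y v : V).

Let oW : open (slit U). Proof. exact: open_slit_tangent. Qed.

Lemma hamel_defectD f g x y v :
  smooth_on (slit U) (uncurried f) -> smooth_on (slit U) (uncurried g) ->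
  U x -> y != 0 ->
  hamel_defect (fun x y => f x y + g x y) x y v =
  hamel_defect f x y v + hamel_defect g x y v.
Proof.
move=> sf sg Ux y0; have Wz : slit U (x, y) by [].
have dD z w : slit U z -> 'D_w (uncurried (fun x y => f x y + g x y)) z =
    'D_w (uncurried f) z + 'D_w (uncurried g) z.
  move=> Wz'.
  exact: (deriveD (smooth_derivable (v := w) sf Wz') (smooth_derivable (v := w) sg Wz')).
rewrite /hamel_defect (dD _ _ Wz) opprD addrACA.
apply: (congr1 (fun d => d + _)).
have -> := @eq_derive_open _ _ _ oW _
  ('D_(0, v) (uncurried f) + 'D_(0, v) (uncurried g)) _ (y, 0) (fun z => dD z (0, v)) Wz.
apply: deriveD.
  exact: (smooth_derivable (smooth_derive _ sf) Wz).
exact: (smooth_derivable (smooth_derive _ sg) Wz).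
Qed.

Lemma hamel_defectZ c f x y v :
  smooth_on (slit U) (uncurried f) -> U x -> y != 0 ->
  hamel_defect (fun x y => c * f x y) x y v = c * hamel_defect f x y v.
Proof.
move=> sf Ux y0; have Wz : slit U (x, y) by [].
have dD z w : slit U z -> 'D_w (uncurried (fun x y => c * f x y)) z =
    c * 'D_w (uncurried f) z.
  by move=> Wz'; exact: (deriveZ c (smooth_derivable (v := w) sf Wz')).
rewrite /hamel_defect (dD _ _ Wz) mulrBr.
apply: (congr1 (fun d => d - _)).
have -> := @eq_derive_open _ _ _ oW _
  (c *: 'D_(0, v) (uncurried f) : V * V -> R^o) _ (y, 0) (fun z => dD z (0, v)) Wz.
by apply: deriveZ; exact: (smooth_derivable (smooth_derive _ sf) Wz).
Qed.

(** In D_x[y] D_y[v] f both y and v change sign at the reflected point, in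
    D_x[v] f nothing does. *)
Lemma hamel_defect_reflect f x y v :
  smooth_on (slit U) (uncurried f) -> U x -> y != 0 ->
  hamel_defect (fun x y => f x (- y)) x y v = hamel_defect f x (- y) v.
Proof.
move=> sf Ux y0; have Wz : slit U (x, - y) by split=> //=; rewrite oppr_eq0.
have rE (w w' : V) : reflect_fiber (w, w') = (w, - w') by [].
have r0 (w : V) : reflect_fiber (w, 0) = (w, 0) by rewrite rE oppr0.
pose g := uncurried (fun x y => f x (- y)).
have gx : 'D_(v, 0) g (x, y) = 'D_(v, 0) (uncurried f) (x, - y).
  by apply: etrans (derive_reflect (uncurried f) (x, y) (v, 0)) _; rewrite r0.
have gy : 'D_(0, v) g = 'D_(0, - v) (uncurried f) \o reflect_fiber.
  by apply/funext => z; exact: (derive_reflect (uncurried f) z (0, v)).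
have gxy : 'D_(y, 0) ('D_(0, v) g) (x, y) =
    'D_(y, 0) ('D_(0, - v) (uncurried f)) (x, - y).
  by rewrite gy; apply: etrans (derive_reflect _ (x, y) (y, 0)) _; rewrite r0.
have pN (w : V) : ((0, - w) : V * V) = - (0, w) by rewrite -scaleN1r pair0Z scaleN1r.
have Np (w : V) : ((- w, 0) : V * V) = - (w, 0) by rewrite -scaleN1r pairZ0 scaleN1r.
apply: etrans (congr2 (fun c d => c - d) gxy gx) _.
apply: (congr1 (fun d => d - _)).
pose h := 'D_(0, v) (uncurried f); have sh : smooth_on (slit U) h by exact: smooth_derive.
have e1 : 'D_(- y, 0) h (x, - y) = - 'D_(y, 0) h (x, - y).
  exact: etrans (congr1 (fun w => 'D_w h (x, - y)) (Np y)) (derive_dirN (y, 0) sh Wz).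
have e2 : 'D_(y, 0) ('D_(0, - v) (uncurried f)) (x, - y) = 'D_(y, 0) (- h) (x, - y).
  apply: (@eq_derive_open _ _ _ oW _ _ (x, - y) (y, 0) _ Wz) => z Wz'.
  exact: etrans (congr1 (fun w => 'D_w (uncurried f) z) (pN v)) (derive_dirN (0, v) sf Wz').
have e3 : 'D_(y, 0) (- h) (x, - y) = - 'D_(y, 0) h (x, - y).
  by apply: deriveN; exact: (smooth_derivable sh Wz).
exact: etrans e2 (etrans e3 (esym e1)).
Qed.

End HamelDefect.

(** * Adding a 1-form to a metric *)

Lemma unitmx_of_kernel (K : fieldType) (n : nat) (A : 'M[K]_n) :
  (forall w : 'rV_n, w *m A = 0 -> w = 0) -> A \in unitmx.
Proof. by move=> kA; rewrite -row_free_unit; exact: inj_row_free. Qed.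

Lemma positive_definite_unitmx (R : realType) (n : nat) (A : 'M[R]_n) :
  (forall v : 'rV_n, v != 0 -> 0 < \sum_i \sum_j A i j * v 0 i * v 0 j) ->
  A \in unitmx.
Proof.
move=> Apos; apply: unitmx_of_kernel => w wA; apply/eqP; apply: contraT => /Apos.
suff -> : \sum_i \sum_j A i j * w 0 i * w 0 j = 0 by rewrite ltxx.
rewrite exchange_big big1 // => j _ /=; rewrite -mulr_suml.
have /rowP/(_ j) := wA; rewrite !mxE => wAj.
by under eq_bigr do rewrite mulrC; rewrite wAj mul0r.
Qed.

Section RandersChange.
Context (R : realType) (n : nat).
Local Notation V := 'rV[R]_n.
Context (U : set V) (oU : open U).
Local Notation Dy v g := ('D_((0, v) : V * V) g).
Local Notation Dx v g := ('D_((v, 0) : V * V) g).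
Implicit Types (f l : V -> V -> R) (x y v w : V).

Let oW : open (slit U). Proof. exact: open_slit_tangent. Qed.

(** Here y is contracted with the inner derivative, in contrast to
    [euler_fiber_derivative].  Deriving Euler's relation
    sum_j y_j D_y[j] f = f along w gives this without exchanging the two
    derivatives. *)
Lemma euler_second_derivative f x y w :
  smooth_on (slit U) (uncurried f) ->
  (forall x y c, U x -> 0 < c -> f x (c *: y) = c * f x y) ->
  U x -> y != 0 ->
  \sum_j y 0 j * Dy w (Dy (delta_mx 0 j) (uncurried f)) (x, y) = 0.
Proof.
move=> sf fhomog Ux y0; have Wz : slit U (x, y) by [].
pose D j : V * V -> R^o := Dy (delta_mx 0 j) (uncurried f).
pose g : V * V -> R^o := fun z => \sum_j (z.2 0 j * D j z : R).
have gE z : slit U z -> g z = uncurried f z.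
  case: z => x' y' Wz'; have [Ux' y'0] := Wz'.
  have := derive_fiber_expand oW sf y' Wz'.
  by rewrite (euler fhomog Ux' y'0) => fE; exact: esym fE.
have dg : is_derive (x, y) ((0, w) : V * V) g (\sum_j (w 0 j * D j (x, y) + y 0 j * Dy w (D j) (x, y))).
  have := @is_derive_sum R (V * V)%type R n (fun j z => z.2 0 j * D j z) (x, y) (0, w)
    (fun j => w 0 j * D j (x, y) + y 0 j * Dy w (D j) (x, y)).
  have -> : \sum_(j < n) (fun z : V * V => z.2 0 j * D j z) = g.
    by apply/funext => z; rewrite fct_sumE.
  apply => j.
  have dj : is_derive (x, y) ((0, w) : V * V) (fun z : V * V => z.2 0 j : R^o) (w 0 j).
    apply: (@is_derive_linear R (V * V)%type R^o (fun z : V * V => z.2 0 j) (x, y) (0, w)) => [a b|c a];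
      by rewrite !mxE.
  exact: (is_derive_mul dj (derivableP (smooth_derivable (smooth_derive _ sf) Wz))).
have dgE : Dy w g (x, y) = Dy w (uncurried f) (x, y).
  exact: (@eq_derive_open _ _ _ oW _ _ (x, y) (0, w) gE Wz).
have [_ dgS] := dg.
move: dgS; rewrite dgE (derive_fiber_expand oW sf w Wz) big_split /=.
by move/esym/eqP; rewrite -subr_eq0 addrAC subrr add0r => /eqP.
Qed.

Definition fiber_linear l : Prop :=
  (forall x y v, l x (y + v) = l x y + l x v) /\ (forall x y c, l x (c *: y) = c * l x y).

Lemma fiber_derivative_linear l z v : fiber_linear l -> Dy v (uncurried l) z = l z.1 v.
Proof.
move=> [lD lZ]; case: z => x y.
apply: etrans (esym (derive_snd (uncurried l) x y v)) _.
by have [_] := @is_derive_linear R V R^o (l x) y v (lD x) (fun c w => lZ x w c).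
Qed.

Lemma fiber_second_derivative_linear l z v w : fiber_linear l ->
  Dy w (Dy v (uncurried l)) z = 0.
Proof.
move=> ll; case: z => x y.
apply: etrans (esym (derive_snd (Dy v (uncurried l)) x y w)) _.
have -> : (fun y' => Dy v (uncurried l) (x, y')) = cst (l x v).
  by apply/funext => y'; exact: fiber_derivative_linear.
exact: derive_cst.
Qed.

(** The right-hand side is the exterior derivative of l on (y, v). *)
Lemma hamel_defect_linear l x y v : fiber_linear l ->
  hamel_defect l x y v = 'D_y (l ^~ v : V -> R^o) x - 'D_v (l ^~ y : V -> R^o) x.
Proof.
move=> ll; apply: (congr2 (fun a b => a - b)).
  apply: etrans (esym (derive_fst (Dy v (uncurried l)) x y y)) _.
  apply: (congr1 (fun g => 'D_y g x)); apply/funext => x'.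
  exact: fiber_derivative_linear.
exact: (esym (derive_fst (uncurried l) x y v)).
Qed.

(** Let w be in the kernel of the tensor g_f.  Contracting g_f(w, .) = 0 with y
    gives D_y[w] f = 0, hence D_y[w] D_y[.] f = 0, which is also
    D_y[w] D_y[.] (f + l).  Then w - c y is in the kernel of the tensor of
    f + l for the c that annihilates D_y (f + l) on it, so w = c y, and
    0 = D_y[w] f = c f forces c = 0. *)
Lemma randers_nondegenerate f l x y :
  smooth_on (slit U) (uncurried f) -> smooth_on (slit U) (uncurried l) ->
  fiber_linear l ->
  (forall x y c, U x -> 0 < c -> f x (c *: y) = c * f x y) ->
  U x -> y != 0 -> 0 < f x y -> 0 < f x y + l x y ->
  fundamental_tensor (fun x y => f x y + l x y) x y \in unitmx ->
  fundamental_tensor f x y \in unitmx.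
Proof.
move=> sf sl ll fhomog Ux y0 fpos Fpos Funit; have Wz : slit U (x, y) by [].
have [lD lZ] := ll.
have sF : smooth_on (slit U) (uncurried (fun x y => f x y + l x y)) by have := smooth_onD oW sf sl; exact.
have Fhomog x' y' c : U x' -> 0 < c ->
    f x' (c *: y') + l x' (c *: y') = c * (f x' y' + l x' y').
  by move=> Ux' c0; rewrite fhomog // lZ mulrDr.
set F := fun x y => f x y + l x y in Funit sF *.
have FE z w : slit U z -> Dy w (uncurried F) z = Dy w (uncurried f) z + l z.1 w.
  move=> Wz'; rewrite -(fiber_derivative_linear z w ll).
  exact: (deriveD (smooth_derivable sf Wz') (smooth_derivable sl Wz')).
have F2E v w : Dy w (Dy v (uncurried F)) (x, y) = Dy w (Dy v (uncurried f)) (x, y).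
  have e1 : Dy w (Dy v (uncurried F)) (x, y) =
      Dy w (Dy v (uncurried f) + Dy v (uncurried l)) (x, y).
    apply: (@eq_derive_open _ _ _ oW _ _ (x, y) (0, w) _ Wz) => z Wz'.
    by rewrite FE // -(fiber_derivative_linear z v ll).
  have e2 := deriveD (smooth_derivable (v := ((0, w) : V * V)) (smooth_derive (0, v) sf) Wz)
    (smooth_derivable (v := ((0, w) : V * V)) (smooth_derive (0, v) sl) Wz).
  by rewrite e1 e2 (fiber_second_derivative_linear (x, y) v w ll) addr0.
apply: unitmx_of_kernel => w wg.
have f0 : f x y != 0 by rewrite gt_eqF.
have wgj j : Dy w (uncurried f) (x, y) * Dy (delta_mx 0 j) (uncurried f) (x, y) +
    f x y * Dy w (Dy (delta_mx 0 j) (uncurried f)) (x, y) = 0.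
  by rewrite -(mulmx_fundamental_tensor oU sf) // wg mxE.
have fw0 : Dy w (uncurried f) (x, y) = 0.
  pose D j : R := Dy (delta_mx 0 j) (uncurried f) (x, y).
  pose H j : R := Dy w (Dy (delta_mx 0 j) (uncurried f)) (x, y).
  have e1 : \sum_j y 0 j * D j = f x y.
    by rewrite -(euler fhomog Ux y0); apply/esym; exact: (derive_fiber_expand oW sf y Wz).
  have e2 : \sum_j y 0 j * H j = 0 by exact: euler_second_derivative.
  apply: (mulIf f0); rewrite mul0r.
  transitivity (\sum_j y 0 j * (Dy w (uncurried f) (x, y) * D j + f x y * H j)).
    under eq_bigr do rewrite mulrDr mulrCA [X in _ + X]mulrCA.
    by rewrite big_split /= -!mulr_sumr e1 e2 mulr0 addr0.
  by rewrite big1 // => j _; rewrite wgj mulr0.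
have fwj j : Dy w (Dy (delta_mx 0 j) (uncurried f)) (x, y) = 0.
  have := wgj j; rewrite fw0 mul0r add0r => /eqP.
  by rewrite mulf_eq0 (negbTE f0) /= => /eqP.
have F0 : F x y != 0 by rewrite gt_eqF.
pose c := Dy w (uncurried F) (x, y) / F x y.
have wcy : w - c *: y = 0.
  apply/eqP; rewrite -subr_eq0 subr0; apply/eqP.
  have dir g : smooth_on (slit U) g -> Dy (w - c *: y) g (x, y) = Dy w g (x, y) - c * Dy y g (x, y).
    move=> sg; have -> : ((0, w - c *: y) : V * V) = (0, w) + (- c) *: ((0, y) : V * V).
      by rewrite -pair0Z -pair0D scaleNr.
    rewrite (derive_dirD oW _ _ sg Wz) (derive_dirZS _ _ sg Wz) mulNr //.
  suff : (w - c *: y) *m fundamental_tensor F x y = 0.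
    by move/(congr1 (mulmxr (invmx (fundamental_tensor F x y)))) => /=; rewrite mulmxK // mul0mx.
  apply/rowP => j; rewrite (mulmx_fundamental_tensor oU sF) // mxE.
  rewrite (dir _ sF) (dir _ (smooth_derive _ sF)).
  rewrite (euler Fhomog) // (euler_fiber_derivative sF Fhomog) // F2E fwj.
  by rewrite /c divfK // subrr mul0r mulr0 subrr mulr0 addr0.
have wE : w = c *: y by apply/eqP; rewrite -subr_eq0; apply/eqP.
have c0 : c = 0.
  apply: (mulIf f0); rewrite mul0r -fw0 wE pair0Z (derive_dirZS _ _ sf Wz).
  by rewrite (euler fhomog).
by rewrite wE c0 scale0r.
Qed.

End RandersChange.

(** * A polynomial identity *)

Lemma poly_eq0_of_horner (K : numFieldType) (P : {poly K}) : (forall t, P.[t] = 0) -> P = 0.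
Proof.
move=> P0; apply/eqP; apply: contraT => Pn0.
have := @max_poly_roots _ P [seq i%:R | i <- iota 0 (size P)] Pn0.
rewrite size_map size_iota ltnn => -> //.
  by apply/allP => _ /mapP[i _ ->]; apply/eqP.
by rewrite map_inj_uniq ?iota_uniq // => i j /eqP; rewrite eqr_nat => /eqP.
Qed.

(** Compare degrees: a nonzero multiple of p + q t^2 has degree at least 2. *)
Lemma small_remainder_vanishes (K : numFieldType) (p q l0 l1 : K) (s : seq K) : q != 0 ->
  (forall t, (p + q * t ^+ 2) * (Poly s).[t] + (l0 + l1 * t) = 0) ->
  [/\ forall i, s`_i = 0, l0 = 0 & l1 = 0].
Proof.
move=> q0 H.
pose P := Poly [:: p; 0; q]; pose L := Poly [:: l0; l1].
have PE : P = [:: p; 0; q] :> seq K by apply: (@PolyK _ 0).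
have E : P * Poly s + L = 0.
  apply: poly_eq0_of_horner => t; rewrite -[RHS](H t) hornerD hornerM !horner_Poly /=.
  by congr (_ * _ + _); ring.
have Ps : Poly s = 0.
  apply/eqP; apply: contraT => s0.
  have : (size (P * Poly s)%R <= 2)%N.
    move/eqP: E; rewrite addr_eq0 => /eqP ->; rewrite size_polyN.
    exact: size_Poly.
  have P0 : P != 0 by rewrite -size_poly_gt0 PE.
  have := s0; rewrite -size_poly_gt0 size_mul // PE.
  by case: (size (Poly s)).
have L0 : L = 0 by move: E; rewrite Ps mulr0 add0r.
split=> [i||]; first by rewrite -coef_Poly Ps coef0.
  by rewrite -[LHS]/([:: l0; l1]`_0) -coef_Poly -/L L0 coef0.
by rewrite -[LHS]/([:: l0; l1]`_1) -coef_Poly -/L L0 coef0.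
Qed.

(** The relation between the derivatives of alpha^2 and beta on the lines
    y = e1 + t e2.  With p = alpha^2(e1), q = alpha^2(e2), r = beta(e1): S is
    alpha^2(y), X is D_x[y] alpha^2(y), N is
    2 D_x[y] <y, e2> - D_x[e2] alpha^2(y) for the scalar product of alpha, W is
    D_x[y] beta(y) and d is d beta (e1, e2).
    Modulo S only 2 r^4 (q t X + r^3 d) survives, so q t X + r^3 d = S V for some
    V of degree 2.  Dividing by S, the coefficients of t^6, t^5, t^4 force
    N = V, and then the constant coefficients give p V(0) = r^3 d and
    r^4 V(0) = - p r^3 d. *)
Lemma quartic_pencil (K : realFieldType) (p q r d a0 a1 a2 a3 n0 n1 n2 w0 w1 w2 : K) :
  0 < p -> 0 < q -> r != 0 ->
  (forall t, let S := p + q * t ^+ 2 in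
    let X := a0 + a1 * t + a2 * t ^+ 2 + a3 * t ^+ 3 in
    let N := n0 + n1 * t + n2 * t ^+ 2 in
    let W := w0 + w1 * t + w2 * t ^+ 2 in
    - S ^+ 2 * q * t * X + S ^+ 3 * N + 2 * r ^+ 3 * d * S ^+ 2
    + r ^+ 4 * (2 * q * t * X + 2 * r ^+ 3 * d) + r ^+ 4 * S * N
    - 6 * S * q * r ^+ 3 * t * W = 0) ->
  d = 0.
Proof.
move=> p0 q0 r0 H.
have pn0 : p != 0 by rewrite gt_eqF.
have qn0 : q != 0 by rewrite gt_eqF.
(* Euclidean division of q t X + r^3 d by S: the quotient is
   v0 + a2 t + a3 t^2 and the remainder h0 + h1 t; m0, m1, m2 are the
   coefficients of N - V, and k those of the quotient of the whole identity
   by S. *)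
pose v0 := a1 - p * a3 / q.
pose h0 := r ^+ 3 * d - p * v0; pose h1 := q * a0 - p * a2.
pose m0 := n0 - v0; pose m1 := n1 - a2; pose m2 := n2 - a3.
pose k := [:: p ^+ 2 * m0 - p * h0 + 3 * r ^+ 3 * d * p + r ^+ 4 * (2 * v0 + n0);
  p ^+ 2 * m1 - p * h1 + r ^+ 4 * (2 * a2 + n1) - 6 * q * r ^+ 3 * w0;
  p ^+ 2 * m2 + 2 * p * q * m0 - q * h0 + 3 * r ^+ 3 * d * q + r ^+ 4 * (2 * a3 + n2)
    - 6 * q * r ^+ 3 * w1;
  2 * p * q * m1 - q * h1 - 6 * q * r ^+ 3 * w2;
  2 * p * q * m2 + q ^+ 2 * m0; q ^+ 2 * m1; q ^+ 2 * m2].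
have [t|kE lE _] := @small_remainder_vanishes K p q (2 * r ^+ 4 * h0) (2 * r ^+ 4 * h1) k qn0.
  rewrite -[RHS](H t) horner_Poly /= /m0 /m1 /m2 /h0 /h1 /v0; field.
  exact: qn0.
have qq : q ^+ 2 != 0 by rewrite expf_neq0.
have rr : 2 * r ^+ 4 != 0 by rewrite mulf_neq0 ?expf_neq0 ?pnatr_eq0.
have h00 : h0 = 0 by apply: (mulfI rr); rewrite lE mulr0.
have m20 : m2 = 0 by apply: (mulfI qq); rewrite mulr0; exact: (kE 6).
have m00 : m0 = 0.
  by apply: (mulfI qq); have := kE 4; rewrite /= m20 !mulr0 add0r.
have := kE 0%N; rewrite /= m00 h00 !mulr0 subr0 add0r.
have n0E : n0 = v0 by apply/eqP; rewrite -subr_eq0; apply/eqP.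
have v0E : v0 = r ^+ 3 * d / p.
  by apply: (mulIf pn0); rewrite divfK // mulrC; apply/esym/eqP; rewrite -subr_eq0; apply/eqP.
rewrite n0E v0E => kk.
have : d * (3 * r ^+ 3 * (p ^+ 2 + r ^+ 4)) = 0.
  by rewrite -[RHS](mulr0 p) -kk; field.
have pr0 : p ^+ 2 + r ^+ 4 != 0.
  by rewrite gt_eqF // ltr_pwDl ?exprn_gt0 // (exprM r 2 2) sqr_ge0.
have cn0 : 3 * r ^+ 3 * (p ^+ 2 + r ^+ 4) != 0.
  by rewrite !mulf_neq0 ?expf_neq0 ?pnatr_eq0.
by move=> dc; apply: (mulIf cn0); rewrite mul0r.
Qed.

(** * Derivatives of the quartic *)

Section QuarticMetric.
Context (R : realType) (n : nat).
Local Notation V := 'rV[R]_n.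
Context (U : set V) (oU : open U).
Context (g : V -> 'M[R]_n) (b : V -> V).
Hypotheses (sg : smooth_on U g) (sb : smooth_on U b).
Hypothesis gsym : forall x, U x -> (g x)^T = g x.
Local Notation Dy v h := ('D_((0, v) : V * V) h).
Local Notation Dx v h := ('D_((v, 0) : V * V) h).
Implicit Types (x y z v w : V).

Let oW : open (slit U). Proof. exact: open_slit_tangent. Qed.

Definition form2 x y z : R := \sum_i \sum_j g x i j * y 0 i * z 0 j.
Definition form1 x y : R := \sum_i b x 0 i * y 0 i.

Lemma form2Dl x y y' z : form2 x (y + y') z = form2 x y z + form2 x y' z.
Proof.
rewrite /form2 -big_split /=; apply: eq_bigr => i _; rewrite -big_split /=.
by apply: eq_bigr => j _; rewrite mxE; ring.
Qed.
Lemma form2Dr x y z z' : form2 x y (z + z') = form2 x y z + form2 x y z'.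
Proof.
rewrite /form2 -big_split /=; apply: eq_bigr => i _; rewrite -big_split /=.
by apply: eq_bigr => j _; rewrite mxE; ring.
Qed.
Lemma form2Zl x c y z : form2 x (c *: y) z = c * form2 x y z.
Proof.
rewrite /form2 mulr_sumr; apply: eq_bigr => i _; rewrite mulr_sumr.
by apply: eq_bigr => j _; rewrite mxE; ring.
Qed.
Lemma form2Zr x c y z : form2 x y (c *: z) = c * form2 x y z.
Proof.
rewrite /form2 mulr_sumr; apply: eq_bigr => i _; rewrite mulr_sumr.
by apply: eq_bigr => j _; rewrite mxE; ring.
Qed.
Lemma form2C x y z : U x -> form2 x y z = form2 x z y.
Proof.
move=> Ux; rewrite /form2 exchange_big /=; apply: eq_bigr => i _; apply: eq_bigr => j _.
by rewrite -[in LHS](gsym Ux) mxE; ring.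
Qed.
Lemma form1D x y y' : form1 x (y + y') = form1 x y + form1 x y'.
Proof. by rewrite /form1 -big_split /=; apply: eq_bigr => i _; rewrite mxE; ring. Qed.
Lemma form1Z x c y : form1 x (c *: y) = c * form1 x y.
Proof. by rewrite /form1 mulr_sumr; apply: eq_bigr => i _; rewrite mxE; ring. Qed.

Lemma smooth_form2 y z : smooth_on U (fun x => form2 x y z : R^o).
Proof.
apply: (smooth_on_sum oU) => i; apply: (smooth_on_sum oU) => j.
apply: (smooth_onM oU); last exact: smooth_on_cst.
by apply: (smooth_onM oU); [exact: smooth_mx_entry | exact: smooth_on_cst].
Qed.

Lemma smooth_form1 y : smooth_on U (fun x => form1 x y : R^o).
Proof.
apply: (smooth_on_sum oU) => i.
by apply: (smooth_onM oU); [exact: smooth_mx_entry | exact: smooth_on_cst].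
Qed.

Definition dform2 w y z x : R := 'D_w (fun x => form2 x y z : R^o) x.
Definition dform1 w y x : R := 'D_w (fun x => form1 x y : R^o) x.

Section AtPoint.
Context (x : V) (Ux : U x).

Lemma is_derive_form2 w y z :
  is_derive x w (fun x => form2 x y z : R^o) (dform2 w y z x).
Proof. exact: derivableP (smooth_derivable (smooth_form2 y z) Ux). Qed.

Lemma is_derive_form1 w y : is_derive x w (fun x => form1 x y : R^o) (dform1 w y x).
Proof. exact: derivableP (smooth_derivable (smooth_form1 y) Ux). Qed.

Lemma dform2_dir w w' c y z :
  dform2 (w + c *: w') y z x = dform2 w y z x + c * dform2 w' y z x.
Proof.
have sS := smooth_form2 y z.
by rewrite /dform2 (derive_dirD oU w (c *: w') sS Ux) (derive_dirZS w' c sS Ux).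
Qed.

Lemma dform1_dir w w' c y :
  dform1 (w + c *: w') y x = dform1 w y x + c * dform1 w' y x.
Proof.
have sS := smooth_form1 y.
by rewrite /dform1 (derive_dirD oU w (c *: w') sS Ux) (derive_dirZS w' c sS Ux).
Qed.

Lemma dform1_lin w y y' c :
  dform1 w (y + c *: y') x = dform1 w y x + c * dform1 w y' x.
Proof.
have d1 := is_derive_form1 w y; have d2 := is_derive_form1 w y'.
have dc := is_derive_mul (is_derive_cst (c : R^o) x w) d2.
have dS := is_derive_add d1 dc.
have dE : is_derive x w (fun x => form1 x (y + c *: y') : R^o) (dform1 w y x + c * dform1 w y' x).
  apply: (is_derive_congr dS) => [z|]; first by rewrite form1D form1Z.
  by rewrite mul0r add0r.
by case: dE.
Qed.

Lemma dform2_linl w y y' c z :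
  dform2 w (y + c *: y') z x = dform2 w y z x + c * dform2 w y' z x.
Proof.
have d1 := is_derive_form2 w y z; have d2 := is_derive_form2 w y' z.
have dc := is_derive_mul (is_derive_cst (c : R^o) x w) d2.
have dS := is_derive_add d1 dc.
have dE : is_derive x w (fun x => form2 x (y + c *: y') z : R^o)
    (dform2 w y z x + c * dform2 w y' z x).
  apply: (is_derive_congr dS) => [x'|]; first by rewrite form2Dl form2Zl.
  by rewrite mul0r add0r.
by case: dE.
Qed.

Lemma dform2C w y z : dform2 w y z x = dform2 w z y x.
Proof.
apply: (@eq_derive_open _ _ _ oU _ _ x w _ Ux) => x' Ux'; exact: form2C.
Qed.

Lemma dform2_linr w y z z' c :
  dform2 w y (z + c *: z') x = dform2 w y z x + c * dform2 w y z' x.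
Proof. by rewrite dform2C dform2_linl !(dform2C w _ y). Qed.

End AtPoint.

Definition quartic x y : R := form2 x y y ^+ 2 + form1 x y ^+ 4.

Lemma is_derive_quartic x y w : U x ->
  is_derive x w (fun x => quartic x y : R^o)
    (2 * form2 x y y * dform2 w y y x + 4 * form1 x y ^+ 3 * dform1 w y x).
Proof.
move=> Ux; have d2 := is_derive_form2 Ux w y y; have d1 := is_derive_form1 Ux w y.
have d11 := is_derive_mul d1 d1.
have dQ := is_derive_add (is_derive_mul d2 d2) (is_derive_mul d11 d11).
apply: (is_derive_congr dQ) => [z|]; first by rewrite /quartic /=; ring.
by move: (dform2 _ _ _ _) (dform1 _ _ _) => c d; ring.
Qed.

(** The derivative of the quartic in the fiber, along v. *)
Definition quartic_fiber x y v : R :=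
  4 * form2 x y y * form2 x y v + 4 * form1 x y ^+ 3 * form1 x v.

Lemma is_derive_fiber_quartic x y v : U x ->
  is_derive y v (fun y => quartic x y : R^o) (quartic_fiber x y v).
Proof.
move=> Ux.
have d1 : is_derive y v (fun y => form1 x y : R^o) (form1 x v).
  by apply: is_derive_linear => [u w|c w]; [exact: form1D | exact: form1Z].
have d2 : is_derive y v (fun y => form2 x y y : R^o) (2 * form2 x y v).
  have -> : (fun y => form2 x y y : R^o) =
      \sum_i (fun y : V => \sum_j (g x i j * y 0 i * y 0 j) : R^o).
    by apply/funext => y'; rewrite fct_sumE.
  have dent i : is_derive y v (fun y : V => y 0 i : R^o) (v 0 i).
    by apply: (@is_derive_linear R V R^o (fun y : V => y 0 i) y v) => [c d|c d]; rewrite !mxE.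
  have dij i j : is_derive y v (fun y : V => g x i j * y 0 i * y 0 j : R^o)
      (g x i j * v 0 i * y 0 j + g x i j * y 0 i * v 0 j).
    have dd := is_derive_mul (is_derive_mul (is_derive_cst (g x i j : R^o) y v) (dent i)) (dent j).
    by apply: (is_derive_congr dd) => //; rewrite mul0r add0r.
  have di i : is_derive y v (fun y : V => \sum_j (g x i j * y 0 i * y 0 j) : R^o)
      (\sum_j (g x i j * v 0 i * y 0 j + g x i j * y 0 i * v 0 j)).
    have dd := @is_derive_sum R V R^o n (fun j y => g x i j * y 0 i * y 0 j) y v _ (dij i).
    by apply: (is_derive_congr dd) => // z; rewrite fct_sumE.
  have dd := @is_derive_sum R V R^o n _ y v _ di.
  apply: (is_derive_congr dd) => //.
  under eq_bigr do rewrite big_split /=.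
  by rewrite big_split /= -/(form2 x v y) -/(form2 x y v) (form2C v y Ux); ring.
have d11 := is_derive_mul d1 d1.
have dQ := is_derive_add (is_derive_mul d2 d2) (is_derive_mul d11 d11).
apply: (is_derive_congr dQ) => [z|]; first by rewrite /quartic /=; ring.
by rewrite /quartic_fiber /=; ring.
Qed.

Lemma is_derive_quartic_fiber x y v w : U x ->
  is_derive x w (fun x => quartic_fiber x y v : R^o)
    (4 * (dform2 w y y x * form2 x y v + form2 x y y * dform2 w y v x)
     + 12 * form1 x y ^+ 2 * dform1 w y x * form1 x v
     + 4 * form1 x y ^+ 3 * dform1 w v x).
Proof.
move=> Ux; have d2 := is_derive_form2 Ux w y y; have d2v := is_derive_form2 Ux w y v.
have d1 := is_derive_form1 Ux w y; have d1v := is_derive_form1 Ux w v.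
have d111 := is_derive_mul (is_derive_mul d1 d1) d1.
have dQ := is_derive_add (is_derive_mul d2 d2v) (is_derive_mul d111 d1v).
have dQ4 := is_derive_mul (is_derive_cst (4 : R^o) x w) dQ.
apply: (is_derive_congr dQ4) => [z|]; first by rewrite /quartic_fiber /=; ring.
move: (dform2 w y y x) (dform2 w y v x) (dform1 w y x) (dform1 w v x) => c d e f'.
by ring.
Qed.

End QuarticMetric.

(** * Hamel's relation for the fourth root of the quartic *)

Section FourthRoot.
Context (R : realType) (n : nat).
Local Notation V := 'rV[R]_n.
Context (U : set V) (oU : open U).
Local Notation Dy v h := ('D_((0, v) : V * V) h).
Local Notation Dx v h := ('D_((v, 0) : V * V) h).
Implicit Types (f : V -> V -> R) (x y v w : V).

Let oW : open (slit U). Proof. exact: open_slit_tangent. Qed.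

(** Division by f never occurs: with A = f^4 the second derivative of A is
    12 f^2 D_x[y] f D_y[v] f + 4 f^3 D_x[y] D_y[v] f, and multiplying by
    4 A = 4 f^4 makes the first term a product of first derivatives of A. *)
Lemma fourth_power_hamel f (A : V * V -> R^o) x y v :
  smooth_on (slit U) (uncurried f) ->
  (forall z, slit U z -> (uncurried f z : R) ^+ 4 = A z) ->
  U x -> y != 0 -> hamel_defect f x y v = 0 ->
  4 * A (x, y) * (Dx y (Dy v A) (x, y) - Dx v A (x, y)) =
  3 * Dx y A (x, y) * Dy v A (x, y).
Proof.
move=> sf fA Ux y0; have Wz : slit U (x, y) by [].
pose F : V * V -> R := uncurried f.
have dA (z w : V * V) : slit U z -> 'D_w A z = 4 * F z ^+ 3 * 'D_w (uncurried f) z.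
  move=> Wz'.
  have dw := derivableP (smooth_derivable (v := w) sf Wz').
  have d2 := is_derive_mul dw dw; have d4 := is_derive_mul d2 d2.
  have d4' : is_derive z w (fun z => F z ^+ 4 : R^o) (4 * F z ^+ 3 * 'D_w (uncurried f) z).
    apply: (is_derive_congr d4) => [z'|]; first by rewrite -/F; ring.
    by rewrite -/F; move: ('D_w _ z) => d; ring.
  have FA z' : slit U z' -> F z' ^+ 4 = A z' by move=> /fA.
  by have [_] := is_derive_open oW FA Wz' d4'.
pose h := Dy v (uncurried f); have sh : smooth_on (slit U) h by exact: smooth_derive.
have d2A : Dx y (Dy v A) (x, y) =
    12 * F (x, y) ^+ 2 * Dx y (uncurried f) (x, y) * h (x, y) + 4 * F (x, y) ^+ 3 * Dx y h (x, y).
  have dw := derivableP (smooth_derivable (v := ((y, 0) : V * V)) sf Wz).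
  have dh := derivableP (smooth_derivable (v := ((y, 0) : V * V)) sh Wz).
  have d3 := is_derive_mul (is_derive_mul dw dw) dw.
  have dd := is_derive_mul (is_derive_mul (is_derive_cst (4 : R^o) (x, y) ((y, 0) : V * V)) d3) dh.
  have e1 := @eq_derive_open _ _ _ oW (Dy v A) (fun z => 4 * (F z * F z * F z) * h z) (x, y) (y, 0) _ Wz.
  rewrite e1; last by move=> z Wz'; rewrite dA // /h; ring.
  have [_ ->] := dd.
  move: (Dx y (uncurried f) (x, y)) (Dx y h (x, y)) => c d.
  by rewrite -[uncurried f (x, y)]/(F (x, y)) /cst; ring.
rewrite /hamel_defect -/h => /eqP; rewrite subr_eq0 => /eqP hE.
rewrite d2A !(dA _ _ Wz) -fA // -/h hE -[uncurried f (x, y)]/(F (x, y)).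
rewrite -[Dy v (uncurried f) (x, y)]/(h (x, y)).
by move: (Dx y (uncurried f) (x, y)) (Dx v (uncurried f) (x, y)) (h (x, y)) => c d e; ring.
Qed.

Context (g : V -> 'M[R]_n) (b : V -> V).
Hypotheses (sg : smooth_on U g) (sb : smooth_on U b).
Hypothesis gsym : forall x, U x -> (g x)^T = g x.
Hypothesis gpos : forall x y, U x -> y != 0 -> 0 < form2 g x y y.

Lemma quartic_hamel_equation f x y v :
  smooth_on (slit U) (uncurried f) ->
  (forall x y, U x -> y != 0 -> f x y ^+ 4 = quartic g b x y) -> hamel U f ->
  U x -> y != 0 ->
  let S := form2 g x y y in let T := form2 g x y v in
  let B := form1 b x y in let C := form1 b x v in
  4 * (S ^+ 2 + B ^+ 4) *
    (4 * (dform2 g y y y x * T + S * dform2 g y y v x)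
     + 12 * B ^+ 2 * dform1 b y y x * C + 4 * B ^+ 3 * dform1 b y v x
     - (2 * S * dform2 g v y y x + 4 * B ^+ 3 * dform1 b v y x)) =
  3 * (2 * S * dform2 g y y y x + 4 * B ^+ 3 * dform1 b y y x) *
    (4 * S * T + 4 * B ^+ 3 * C).
Proof.
move=> sf fq hf Ux y0 S T B C; have Wz : slit U (x, y) by [].
pose A : V * V -> R^o := uncurried (quartic g b).
have fA z : slit U z -> (uncurried f z : R) ^+ 4 = A z.
  by case: z => x' y' [Ux' y'0]; exact: fq.
have hd : hamel_defect f x y v = 0 by rewrite /hamel_defect hf // subrr.
have := fourth_power_hamel sf fA Ux y0 hd.
have Ax w : Dx w A (x, y) = 2 * S * dform2 g w y y x + 4 * B ^+ 3 * dform1 b w y x.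
  apply: etrans (esym (derive_fst A x y w)) _.
  by have [_ <-] := is_derive_quartic oU sg sb y w Ux.
have Ay z w : slit U z -> Dy w A z = quartic_fiber g b z.1 z.2 w.
  case: z => x' y' [Ux' y'0]; apply: etrans (esym (derive_snd A x' y' w)) _.
  by have [_ <-] := is_derive_fiber_quartic b gsym y' w Ux'.
have Axy : Dx y (Dy v A) (x, y) = 4 * (dform2 g y y y x * T + S * dform2 g y y v x)
     + 12 * B ^+ 2 * dform1 b y y x * C + 4 * B ^+ 3 * dform1 b y v x.
  have e1 := @eq_derive_open _ _ _ oW (Dy v A)
    (fun z => quartic_fiber g b z.1 z.2 v : R^o) (x, y) (y, 0) (fun z => Ay z v) Wz.
  apply: etrans e1 _.
  apply: etrans (esym (derive_fst (fun z => quartic_fiber g b z.1 z.2 v : R^o) x y y)) _.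
  by have [_ <-] := is_derive_quartic_fiber oU sg sb y v y Ux.
by rewrite Axy !Ax (Ay _ _ Wz).
Qed.

(** Hamel's relation on all vectors y + t v, in the direction v. *)
Lemma closed_in_plane f x y v :
  smooth_on (slit U) (uncurried f) ->
  (forall x y, U x -> y != 0 -> f x y ^+ 4 = quartic g b x y) -> hamel U f ->
  U x -> form1 b x y != 0 -> form1 b x v = 0 -> form2 g x y v = 0 -> v != 0 ->
  dform1 b y v x = dform1 b v y x.
Proof.
move=> sf fq hf Ux By Bv Syv v0.
have form10 : form1 b x 0 = 0 by rewrite -(scale0r 0) form1Z mul0r.
have y0 : y != 0 by apply: contraNneq By => ->; rewrite form10.
apply/eqP; rewrite -subr_eq0; apply/eqP.
pose p := form2 g x y y; pose q := form2 g x v v; pose r := form1 b x y.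
apply: (@quartic_pencil R p q r _
  (dform2 g y y y x) (2 * dform2 g y y v x + dform2 g v y y x)
  (dform2 g y v v x + 2 * dform2 g v y v x) (dform2 g v v v x)
  (2 * dform2 g y y v x - dform2 g v y y x) (2 * dform2 g y v v x) (dform2 g v v v x)
  (dform1 b y y x) (dform1 b y v x + dform1 b v y x) (dform1 b v v x)) => //;
  [exact: gpos | exact: gpos | move=> t S X N W].
have Bt : form1 b x (y + t *: v) = r by rewrite form1D form1Z Bv mulr0 addr0.
have yt0 : y + t *: v != 0.
  by apply: contraNneq By => yt; rewrite -/r -Bt yt form10.
have Svy : form2 g x v y = 0 by rewrite (form2C gsym).
have := quartic_hamel_equation v sf fq hf Ux yt0.
rewrite /= Bt Bv !form2Dl !form2Dr !form2Zl !form2Zr Syv Svy -/p -/q.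
rewrite !(dform2_dir oU sg Ux) !(dform1_dir oU sb Ux) !(dform2_linl oU sg Ux)
  !(dform2_linr oU sg gsym Ux) !(dform1_lin oU sb Ux).
rewrite !(dform2C oU gsym Ux _ v y).
rewrite /S /X /N /W.
move: (dform2 g y y y x) (dform2 g y y v x) (dform2 g y v v x) (dform2 g v y y x)
  (dform2 g v y v x) (dform2 g v v v x) (dform1 b y y x) (dform1 b y v x)
  (dform1 b v y x) (dform1 b v v x) => c1 c2 c3 c4 c5 c6 e1 e2 e3 e4 E.
(* All coefficients of the relation are multiples of 8. *)
have n8 : (8 : R) != 0 by rewrite pnatr_eq0.
apply: (mulfI n8); rewrite mulr0; move/eqP: E; rewrite -subr_eq0 => /eqP <-.
by ring.
Qed.

End FourthRoot.

(** * The Randers change of the quartic metric *)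

Section RandersChangeOfQuartic.
Context (R : realType) (n : nat).
Local Notation V := 'rV[R]_n.
Context (U : set V) (oU : open U).
Context (g : V -> 'M[R]_n) (b : V -> V).
Hypotheses (sg : smooth_on U g) (sb : smooth_on U b).
Hypothesis gsym : forall x, U x -> (g x)^T = g x.
Hypothesis gpos : forall x y : V, U x -> y != 0 -> 0 < form2 g x y y.
Implicit Types (f : V -> V -> R) (x y v w : V).

Let oW : open (slit U). Proof. exact: open_slit_tangent. Qed.

(** The difference of the two sides is alternating, so it does not change when a
    multiple of y is added to v, then a multiple of v to y; this reduces to
    beta(v) = 0 and y, v orthogonal. *)
Lemma closed_of_nonzero f x y v :
  smooth_on (slit U) (uncurried f) ->
  (forall x y, U x -> y != 0 -> f x y ^+ 4 = quartic g b x y) -> hamel U f ->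
  U x -> form1 b x y != 0 -> dform1 b y v x = dform1 b v y x.
Proof.
move=> sf fq hf Ux By.
pose c := form1 b x v / form1 b x y.
have [e [vE Be]] : exists e, v = e + c *: y /\ form1 b x e = 0.
  exists (v + (- c) *: y); split; first by rewrite scaleNr subrK.
  by rewrite form1D form1Z mulNr /c divfK // subrr.
suff yeE : dform1 b y e x = dform1 b e y x.
  by rewrite vE (dform1_lin oU sb Ux) (dform1_dir oU sb Ux) yeE.
have [->|e0] := eqVneq e 0.
  have z0 w : dform1 b w 0 x = 0.
    have := dform1_lin oU sb Ux w 0 0 (-1).
    by rewrite scaler0 addr0 mulN1r subrr.
  have z0' w : dform1 b 0 w x = 0 by rewrite /dform1 derive0.
  by rewrite z0 z0'.
pose m := form2 g x y e / form2 g x e e.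
have [d [yE Sd]] : exists d, y = d + m *: e /\ form2 g x d e = 0.
  exists (y + (- m) *: e); split; first by rewrite scaleNr subrK.
  by rewrite form2Dl form2Zl mulNr /m divfK ?subrr // gt_eqF ?gpos.
have Bd : form1 b x d != 0.
  by move: By; rewrite yE form1D form1Z Be mulr0 addr0.
have := closed_in_plane oU sg sb gsym gpos sf fq hf Ux Bd Be Sd e0.
by rewrite yE (dform1_lin oU sb Ux) (dform1_dir oU sb Ux) => ->.
Qed.

(** If d beta (y, v) is nonzero at x, it is so on a neighborhood of x, where
    beta(y) and beta(v) must then vanish; so their derivatives at x vanish. *)
Lemma closed_of_hamel f x y v :
  smooth_on (slit U) (uncurried f) ->
  (forall x y, U x -> y != 0 -> f x y ^+ 4 = quartic g b x y) -> hamel U f ->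
  U x -> dform1 b y v x = dform1 b v y x.
Proof.
move=> sf fq hf Ux.
have cl := closed_of_nonzero _ sf fq hf.
apply/eqP; rewrite -subr_eq0; apply: contraT => nz.
pose phi x : R := dform1 b y v x - dform1 b v y x.
have sphi : smooth_on U (phi : V -> R^o).
  have s1 : smooth_on U (dform1 b y v : V -> R^o) by exact: smooth_derive (smooth_form1 oU sb v).
  have s2 : smooth_on U (dform1 b v y : V -> R^o) by exact: smooth_derive (smooth_form1 oU sb y).
  exact: (smooth_onD oU s1 (smooth_onN oU s2)).
have cphi : \forall x' \near x, phi x' != 0.
  have phix : 0 < `|phi x| by rewrite normr_gt0.
  have /cvgrPdist_lt /(_ _ phix) := smooth_continuous sphi Ux.
  apply: filterS => x' /= xx'; apply: contraTneq xx' => ->.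
  by rewrite subr0 ltxx.
have nearB w w' : (forall x', U x' -> phi x' != 0 -> form1 b x' w = 0) ->
    dform1 b w' w x = 0.
  move=> Bw; rewrite /dform1 (@near_eq_derive _ _ _ _ (cst 0)) ?derive_cst //.
  near=> x'; apply: Bw; near: x'; [exact: (near_open oU Ux) | exact: cphi].
move: nz; rewrite !nearB ?subrr ?eqxx // => x' Ux' /eqP phi0.
  apply/eqP; apply: contraT => B0; case: phi0.
  by rewrite /phi (cl _ _ v Ux' B0) subrr.
apply/eqP; apply: contraT => B0; case: phi0.
by rewrite /phi (cl _ _ y Ux' B0) subrr.
Unshelve. all: by end_near. Qed.

Definition quartic_norm x y : R :=
  (Num.sqrt (form2 g x y y) ^+ 4 + form1 b x y ^+ 4) `^ (4^-1).

Definition randers_norm x y : R := quartic_norm x y + form1 b x y.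

Lemma quartic_norm_arg x y : U x ->
  y != 0 -> Num.sqrt (form2 g x y y) ^+ 4 + form1 b x y ^+ 4 = quartic g b x y.
Proof.
move=> Ux y0; rewrite (exprM _ 2 2) sqr_sqrtr //.
exact: ltW (gpos Ux y0).
Qed.

Lemma quartic_gt0 x y : U x -> y != 0 -> 0 < quartic g b x y.
Proof.
move=> Ux y0; rewrite ltr_pwDl ?exprn_gt0 ?gpos //.
by rewrite (exprM _ 2 2) sqr_ge0.
Qed.

Lemma quartic_norm_exp4 x y : U x -> y != 0 -> quartic_norm x y ^+ 4 = quartic g b x y.
Proof.
move=> Ux y0; rewrite /quartic_norm quartic_norm_arg // -powR_mulrn ?powR_ge0 //.
by rewrite -powRrM mulVf ?pnatr_eq0 // powRr1 // ltW // quartic_gt0.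
Qed.

Lemma quartic_norm_gt0 x y : U x -> y != 0 -> 0 < quartic_norm x y.
Proof. by move=> Ux y0; rewrite powR_gt0 // quartic_norm_arg // quartic_gt0. Qed.

Lemma form1N x y : form1 b x (- y) = - form1 b x y.
Proof. by rewrite -scaleN1r form1Z mulN1r. Qed.

(** The fourth root is the even part of its Randers change. *)
Lemma quartic_norm_average :
  quartic_norm = fun x y => 2^-1 * (randers_norm x y + randers_norm x (- y)).
Proof.
apply/funext => x; apply/funext => y.
have qN : quartic_norm x (- y) = quartic_norm x y.
  rewrite /quartic_norm form1N -scaleN1r form2Zl form2Zr !mulN1r opprK.
  by congr ((_ + _) `^ _); ring.
by rewrite /randers_norm qN form1N; field.
Qed.

Hypothesis regF : regular_metric U randers_norm.

Let sF : smooth_on (slit U) (uncurried randers_norm).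
Proof. by case: regF. Qed.

Let sFr : smooth_on (slit U) (uncurried (fun x y => randers_norm x (- y))).
Proof. exact: (smooth_reflect oU sF). Qed.

Let sFF : smooth_on (slit U) (uncurried (fun x y => randers_norm x y + randers_norm x (- y))).
Proof. by have := smooth_onD oW sF sFr; exact. Qed.

Lemma smooth_quartic_norm : smooth_on (slit U) (uncurried quartic_norm).
Proof. by rewrite quartic_norm_average; have := smooth_onZ oW (2^-1) sFF; exact. Qed.

Lemma smooth_fiber_form1 : smooth_on (slit U) (uncurried (form1 b)).
Proof.
apply: (smooth_on_eq oW (smooth_onD oW sF (smooth_onN oW smooth_quartic_norm))) => z _.
by rewrite /uncurried /randers_norm addrAC subrr add0r.
Qed.

Lemma fiber_linear_form1 : fiber_linear (form1 b).
Proof. by split=> [x y v|x y c]; [exact: form1D | exact: form1Z]. Qed.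

Lemma regular_quartic_norm : regular_metric U quartic_norm.
Proof.
have [_ Fpos Fhomog Funit] := regF.
have fhomog x y c : U x -> 0 < c -> quartic_norm x (c *: y) = c * quartic_norm x y.
  move=> Ux c0; rewrite quartic_norm_average -scalerN !Fhomog //.
  by rewrite -mulrDr mulrCA.
split=> [||//|x y Ux y0]; [exact: smooth_quartic_norm | exact: quartic_norm_gt0 |].
apply: (randers_nondegenerate oU smooth_quartic_norm smooth_fiber_form1
  fiber_linear_form1 fhomog Ux y0 (quartic_norm_gt0 Ux y0) (Fpos _ _ Ux y0)).
exact: Funit.
Qed.

(** One direction takes the even part of F, the other one adds the form
    beta, which is closed by [closed_of_hamel]. *)
Lemma hamel_randers_iff : hamel U randers_norm <-> hamel U quartic_norm.
Proof.
split=> H x y v Ux y0; apply/eqP; rewrite -subr_eq0; apply/eqP; rewrite -/(hamel_defect _ x y v).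
- have HF y' : y' != 0 -> hamel_defect randers_norm x y' v = 0.
    by move=> y'0; rewrite /hamel_defect H // subrr.
  rewrite quartic_norm_average (hamel_defectZ oU) // (hamel_defectD oU) //.
  by rewrite (hamel_defect_reflect oU) // !HF ?oppr_eq0 // addr0 mulr0.
- rewrite /randers_norm (hamel_defectD oU v smooth_quartic_norm smooth_fiber_form1) //.
  rewrite (hamel_defect_linear x y v fiber_linear_form1).
  have cl := closed_of_hamel y v smooth_quartic_norm quartic_norm_exp4 H Ux.
  by rewrite -/(dform1 b y v x) -/(dform1 b v y x) cl subrr addr0 /hamel_defect H // subrr.
Qed.

Lemma straight_randers_iff :
  (forall t0 t1 u, geodesic randers_norm U t0 t1 u -> on_straight_line t0 t1 u) <->
  (forall t0 t1 u, geodesic quartic_norm U t0 t1 u -> on_straight_line t0 t1 u).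
Proof.
have s1 := straight_geodesics_iff_hamel oU regF.
have s2 := straight_geodesics_iff_hamel oU regular_quartic_norm.
exact: (iff_trans s1 (iff_trans hamel_randers_iff (iff_sym s2))).
Qed.

End RandersChangeOfQuartic.

(** * The theorem *)

Unset Implicit Arguments.
Set Strict Implicit.
Set Printing Implicit Defensive.

Theorem theorem4p1 (R : realType) (n : nat) (M : smooth_manifold R n)
    (a : riemannian_metric M) (b : one_form M) (F Ft : tm_expression M)
    (hM : connected [set: M])
    (hFt : Ft = fun c x y =>
       (alpha a c x y ^+ 4 + beta b c x y ^+ 4) `^ (4^-1))
    (hF : F = fun c x y =>
       (alpha a c x y ^+ 4 + beta b c x y ^+ 4) `^ (4^-1) + beta b c x y)
    (hFinsler : finsler_metric F) :
  projectively_flat F <-> projectively_flat Ft.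
Proof.
suff chartwise c : coordinates M c ->
    (forall t0 t1 u, geodesic (F c) (cimg c) t0 t1 u -> on_straight_line t0 t1 u) <->
    (forall t0 t1 u, geodesic (Ft c) (cimg c) t0 t1 u -> on_straight_line t0 t1 u).
  split=> flat p; have [c [cM cp straight]] := flat p; exists c;
    have [FFt FtF] := chartwise c cM.
    by split; [exact: cM | exact: cp | exact: FFt].
  by split; [exact: cM | exact: cp | exact: FtF].
move=> cM.
have [_ /(_ c cM) [sF Fpos Fhomog Fconv]] := hFinsler.
have -> : Ft c = quartic_norm (gcoef a c) (bcoef b c) by rewrite hFt.
have FE : F c = randers_norm (gcoef a c) (bcoef b c) by rewrite hF.
have regF : regular_metric (cimg c) (randers_norm (gcoef a c) (bcoef b c)).
  rewrite -FE; split; [exact: sF | exact: Fpos | exact: Fhomog |].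
  move=> x y cx y0; apply: positive_definite_unitmx => v v0.
  exact: Fconv.
rewrite FE; apply: straight_randers_iff => //.
- exact: cimg_open.
- exact: gcoef_smooth.
- exact: bcoef_smooth.
- by move=> x cx; exact: gcoef_sym.
- by move=> x y cx y0; exact: gcoef_posdef.
Qed.
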